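(* Let $n\ge 0$ be an integer, $0\le\beta<1$, $\alpha>0$, and let $c$ be a real number with $\alpha+c>0$. Let $F\in T_n^\alpha(\beta)$, and let $f$ be given by $$F(z)^\alpha=\frac{\alpha+c}{z^c}\int_0^z t^{c-1}f(t)^\alpha\,dt .$$ Then $f$ is in $T_n^\alpha(\beta)$ for $|z|<r_0(\alpha,c)$, that is, $$\operatorname{Re}\frac{D^nf(z)^\alpha}{\alpha^nz^\alpha}>\beta\quad\text{for all } |z|<r_0(\alpha,c),$$ where $$r_0(\alpha,c)=\frac{(1+(\alpha+c)^2)^{1/2}-1}{\alpha+c}.$$ The result is sharp: $r_0(\alpha,c)$ cannot be replaced by any larger number such that the conclusion holds for all $F\in T_n^\alpha(\beta)$.
   Context: $E=\{z\in\mathbb C:|z|<1\}$ is the unit disk. $A$ is the class of functions $f(z)=z+a_2z^2+\cdots$ analytic in $E$. The Salagean operator is defined by $D^0g=g$ and $D^ng(z)=z\,[D^{n-1}g(z)]'$ for $n\ge 1$. The expression $D^nf(z)^\alpha$ means $D^n$ applied to the function $z\mapsto f(z)^\alpha$. All powers are principal determinations: $F(z)^\alpha=z^\alpha H(z)$, where $H(z)=(F(z)/z)^\alpha$ is the analytic branch with $H(0)=1$, and similarly $f(z)^\alpha=z^\alpha h(z)$ with $h(0)=1$. Thus $D(z^\alpha h(z))=z^\alpha(\alpha h(z)+zh'(z))$, and $D^nf(z)^\alpha/z^\alpha$ is a single-valued analytic function. The integral relation determines $f^\alpha$ from $F$: it is equivalent to $(\alpha+c)f(z)^\alpha=DF(z)^\alpha+cF(z)^\alpha$,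 i.e. $(\alpha+c)h(z)=(\alpha+c)H(z)+zH'(z)$ with $h$ analytic in $E$. Expressions with a removable singularity at $z=0$ are given their limiting value there. $T_n^\alpha(\beta)$ is the class of $f\in A$ satisfying $\operatorname{Re}\dfrac{D^nf(z)^\alpha}{\alpha^nz^\alpha}>\beta$ for all $z\in E$. *)

(* Defs.v *)
From Stdlib Require Import Reals.
From Coquelicot Require Import Coquelicot.

Open Scope R_scope.

Definition Cexp (z : C) : C := (exp (Re z) * cos (Im z), exp (Re z) * sin (Im z)).

(* Complex differentiability at every point of the open disk |z| < r. *)
Definition analytic_in (r : R) (f : C -> C) : Prop :=
  forall z : C, Cmod z < r -> @ex_derive C_AbsRing C_NormedModule f z.

Definition class_A (f : C -> C) : Prop :=
  analytic_in 1 f /\ f (RtoC 0) = RtoC 0 /\ C_derive f (RtoC 0) = RtoC 1.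

(* f(z)^alpha = z^alpha h(z) on |z| < r with the principal determination:
   h = (f(z)/z)^alpha = exp (alpha L), where L is the analytic branch of
   log (f(z)/z) with L(0) = 0; in particular h(0) = 1.  Multivalued functions
   z^alpha h(z) are represented throughout by the factor h. *)
Definition power_branch (r alpha : R) (f h : C -> C) : Prop :=
  exists L : C -> C,
    analytic_in r L /\ L (RtoC 0) = RtoC 0 /\
    forall z : C, Cmod z < r ->
      f z = (z * Cexp (L z))%C /\ h z = Cexp (RtoC alpha * L z)%C.

(* The operator D g = z g' acting on g = z^alpha h, read on the factor h:
   D (z^alpha h) = z^alpha (alpha h + z h'), see [salagean_factor_correct]. *)
Definition salagean_factor (alpha : R) (h : C -> C) : C -> C :=
  fun z => (RtoC alpha * h z + z * C_derive h z)%C.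

Lemma is_derive_C_AbsRing (f : C -> C) (z l : C) :
  @is_derive C_AbsRing C_NormedModule f z l <->
  @is_derive C_AbsRing (AbsRing_NormedModule C_AbsRing) f z l.
Proof.
split; intros [[H1 H2 H3] H4]; (split; [split; [exact H1 | exact H2 | exact H3] | exact H4]).
Qed.

Lemma salagean_factor_correct (alpha : R) (P h : C -> C) (z : C) :
  z <> RtoC 0 ->
  (* P is a local branch of z^alpha *)
  @is_derive C_AbsRing C_NormedModule P z (RtoC alpha * P z / z)%C ->
  @ex_derive C_AbsRing C_NormedModule h z ->
  (z * C_derive (fun w => P w * h w) z)%C = (P z * salagean_factor alpha h z)%C.
Proof.
intros Hz HP Hh.
assert (Hh' := C_derive_correct h z z Hh).
apply is_derive_C_AbsRing in HP; apply is_derive_C_AbsRing in Hh'.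
assert (HM := @is_derive_mult C_AbsRing P h z _ _ HP Hh' Cmult_comm).
apply is_derive_C_AbsRing in HM.
assert (E := is_C_derive_unique _ _ _ HM).
unfold plus, mult in E; simpl in E.
rewrite E; unfold salagean_factor.
field; exact Hz.
Qed.

(* D^n f(z)^alpha / (alpha^n z^alpha) for f^alpha = z^alpha h. *)
Definition salagean_quot (n : nat) (alpha : R) (h : C -> C) (z : C) : C :=
  (Nat.iter n (salagean_factor alpha) h z / RtoC (alpha ^ n))%C.

Definition class_T (n : nat) (alpha beta : R) (F : C -> C) : Prop :=
  class_A F /\
  exists H : C -> C, power_branch 1 alpha F H /\
    forall z : C, Cmod z < 1 -> beta < Re (salagean_quot n alpha H z).

(* F^alpha = (alpha + c) z^(-c) \int_0^z t^(c-1) f(t)^alpha dt, where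
   F^alpha = z^alpha H and f^alpha = z^alpha h with h analytic in the unit disk.
   Along the segment t = s z (0 < s <= 1) the integrand is
   z^(alpha+c) s^(alpha+c-1) h(s z) ds, and the common factor z^(alpha+c)
   cancels; the integral is improper at s = 0 when alpha + c < 1.
   The relation determines h, which may vanish in the unit disk, so that f is in
   general analytic only on a smaller disk: f^alpha = z^alpha h is required near
   0, and determines h in the whole unit disk by analytic continuation. *)
Definition integral_relation (alpha c : R) (F f h : C -> C) : Prop :=
  exists H : C -> C,
    power_branch 1 alpha F H /\
    analytic_in 1 h /\
    (exists rho : R, 0 < rho /\ power_branch rho alpha f h) /\
    forall z : C, Cmod z < 1 ->
      exists I : C,
        @is_RInt_gen C_R_NormedModule
          (fun s : R => (RtoC (Rpower s (alpha + c - 1)) * h (RtoC s * z))%C)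
          (at_right 0) (at_point 1) I /\
        H z = (RtoC (alpha + c) * I)%C.

Definition r0 (alpha c : R) : R :=
  (sqrt (1 + (alpha + c) ^ 2) - 1) / (alpha + c).

(* Main.v *)
Require Import Defs.
From Stdlib Require Import Reals Lra Lia Psatz.
From Coquelicot Require Import Coquelicot.

Open Scope R_scope.

(* Write a = alpha + c, p = D^n F^alpha / (alpha^n z^alpha) and q for the same quotient of f.
   The integral relation says a h = a H + z H', hence q = p + z p' / a.  For u = Re p - beta > 0,
   Poisson's formula on |z| = rho shows that u(s e) (rho + s) / (rho - s) is nondecreasing in s for
   every direction e, so that Re (z p') >= - 2 rho s u / (rho^2 - s^2) at |z| = s < rho < 1; letting
   rho be close to 1 gives Re q > beta as soon as 2 s < a (1 - s^2), that is s < r0.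

   The only complex analysis needed is Cauchy's formula for functions with a continuous
   derivative: z H' = a (h - H) is continuous because h is, so Goursat's theorem is avoided.
   Power series then turn D into the multiplication of the k-th coefficient by alpha + k.

   For sharpness, take p = beta + (1 - beta) (1 + z) / (1 - z); then q(-r0) = beta. *)

(** * Complex and curve derivatives *)

(** Against the factor [(rho + s) / (rho - s)], Poisson's kernel becomes
    [(rho + s)^2 / |w - s e|^2], which does not decrease in [s] for any [w] on the circle and is
    constant at [w = - rho e]. Mass concentrated at that point is thus the extremal case: the [p]
    chosen for sharpness belongs to the point mass at 1, so equality occurs in the direction
    [e = -1]. The radius [rho] stays below 1 because nothing is known of [F] on the unit circle. Two
    further difficulties concern the powers. The branch of [F^alpha] in the class and the one in the
    integral relation are given separately, and the uniqueness of the logarithm has to identify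
    them. For sharpness, [p] must come from an actual [F]: the function [H] recovered from [p] by
    inverting [D] [n] times must have a logarithm, and this holds because the inversion is an
    averaging along rays, which keeps real parts positive. The resulting [h] may still vanish, so
    [f^alpha] is constructed near 0 only. *)

Notation is_cderive f z l := (@is_derive C_AbsRing C_NormedModule f z l).
Notation Ccontinuous f x := (@continuous _ C_UniformSpace f x).

Lemma C_ext (a b : C) : Re a = Re b -> Im a = Im b -> a = b.
Proof. destruct a, b; unfold Re, Im; simpl; intros; subst; reflexivity. Qed.

Lemma Re_mult (a b : C) : Re (a * b)%C = Re a * Re b - Im a * Im b.
Proof. reflexivity. Qed.
Lemma Im_mult (a b : C) : Im (a * b)%C = Re a * Im b + Im a * Re b.
Proof. reflexivity. Qed.
Lemma im_le_Cmod (c : C) : Rabs (Im c) <= Cmod c.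
Proof.
apply Rle_trans with (2 := Rmax_Cmod c). apply Rmax_r.
Qed.
Lemma Cmod_le_Re_Im (c : C) : Cmod c <= Rabs (Re c) + Rabs (Im c).
Proof.
unfold Cmod. apply Rsqr_incr_0_var; [ | generalize (Rabs_pos (Re c)), (Rabs_pos (Im c)); lra].
rewrite Rsqr_sqrt by nra. unfold Rsqr, Re, Im.
assert (forall x, x ^ 2 = Rabs x * Rabs x) as E
  by (intros; rewrite <- Rabs_mult, Rabs_pos_eq; nra).
rewrite !E. generalize (Rabs_pos (fst c)), (Rabs_pos (snd c)); nra.
Qed.

(** The product structure on [C] has square balls while [Cmod] has disks; each contains the other
    after a change of radius by at most the factor [sqrt 2], so the neighbourhoods agree. *)
Lemma locally_Cmod (z : C) (P : C -> Prop) :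
  @locally C_UniformSpace z P <->
  exists d, 0 < d /\ forall w, Cmod (w - z) < d -> P w.
Proof.
split.
- intros [d Hd]. exists d; split; [apply cond_pos|]. intros w Hw. apply Hd.
  apply C_NormedModule_mixin_compat1. exact Hw.
- intros [d [Hd H]].
  assert (S2 : 0 < sqrt 2) by (apply sqrt_lt_R0; lra).
  assert (Hp : 0 < d / sqrt 2) by (apply Rdiv_lt_0_compat; auto).
  exists (mkposreal _ Hp). intros w Hw. apply H.
  apply (C_NormedModule_mixin_compat2 z w) in Hw. simpl in Hw.
  replace (sqrt 2 * (d / sqrt 2)) with d in Hw by (field; lra). exact Hw.
Qed.

Lemma locally_C_AbsRing (z : C) (P : C -> Prop) :
  @locally (AbsRing_UniformSpace C_AbsRing) z P <->
  exists d, 0 < d /\ forall w, Cmod (w - z) < d -> P w.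
Proof.
split.
- intros [d Hd]. exists d; split; [apply cond_pos|]. intros w Hw. apply Hd. exact Hw.
- intros [d [Hd H]]. exists (mkposreal d Hd). intros w Hw. apply H. exact Hw.
Qed.

Lemma is_cderive_eps (f : C -> C) (z l : C) :
  is_cderive f z l <->
  forall eps, 0 < eps -> exists d, 0 < d /\ forall w, Cmod (w - z) < d ->
    Cmod (f w - f z - l * (w - z)) <= eps * Cmod (w - z).
Proof.
split.
- intros [_ H] eps He.
  specialize (H z (fun P Q => Q) (mkposreal eps He)).
  apply locally_C_AbsRing in H. destruct H as [d [Hd H]].
  exists d; split; auto. intros w Hw. specialize (H w Hw).
  rewrite (Cmult_comm l). exact H.
- intros H. split.
  + apply (is_linear_scal_l l).
  + intros x Hx.
    apply (@is_filter_lim_locally_unique C_AbsRing (AbsRing_NormedModule C_AbsRing) z x) in Hx.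
    subst x.
    intros eps. apply locally_C_AbsRing.
    destruct (H eps (cond_pos eps)) as [d [Hd H']]. exists d; split; auto.
    intros w Hw. specialize (H' w Hw). rewrite (Cmult_comm l) in H'. exact H'.
Qed.

Lemma is_cderive_continuous (f : C -> C) (z l : C) : is_cderive f z l -> Ccontinuous (f : C_UniformSpace -> C) z.
Proof.
intros H. rewrite is_cderive_eps in H.
intros P HP. apply locally_Cmod in HP. destruct HP as [e [He HP]].
apply locally_Cmod.
destruct (H 1 Rlt_0_1) as [d [Hd H']].
set (K := 1 + Cmod l + 1).
assert (HK : 0 < K) by (unfold K; generalize (Cmod_ge_0 l); lra).
exists (Rmin d (e / K)). split.
{ apply Rmin_glb_lt; auto. apply Rdiv_lt_0_compat; auto. }
intros w Hw. apply HP.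
assert (H1 := H' w (Rlt_le_trans _ _ _ Hw (Rmin_l _ _))).
assert (H2 := Rlt_le_trans _ _ _ Hw (Rmin_r _ _)).
replace (f w - f z)%C with ((f w - f z - l * (w - z)) + l * (w - z))%C by ring.
eapply Rle_lt_trans. apply Cmod_triangle. rewrite Cmod_mult.
apply Rle_lt_trans with (K * Cmod (w - z)).
{ unfold K. generalize (Cmod_ge_0 (w - z)%C). nra. }
apply Rmult_lt_compat_l with (r := K) in H2; auto.
replace (K * (e / K)) with e in H2 by (field; lra). exact H2.
Qed.

Lemma is_cderive_ext_loc (f g : C -> C) (z l : C) (r : R) :
  0 < r -> (forall w, Cmod (w - z) < r -> f w = g w) -> is_cderive f z l -> is_cderive g z l.
Proof.
intros Hr E H. apply is_derive_ext_loc with f; auto.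
apply locally_C_AbsRing. exists r; auto.
Qed.

Lemma is_cderive_disk_ext (f g : C -> C) (z l : C) (r : R) :
  Cmod z < r -> (forall w, Cmod w < r -> f w = g w) -> is_cderive f z l -> is_cderive g z l.
Proof.
intros Hr E H. apply is_cderive_ext_loc with f (r - Cmod z); auto. lra.
intros w Hw. apply E. replace w with ((w - z) + z)%C by ring.
eapply Rle_lt_trans. apply Cmod_triangle. lra.
Qed.

Lemma is_cderive_eq (f : C -> C) (z l l' : C) : is_cderive f z l -> l = l' -> is_cderive f z l'.
Proof. intros; subst; auto. Qed.

Lemma is_cderive_unique (f : C -> C) (z l l' : C) : is_cderive f z l -> is_cderive f z l' -> l = l'.
Proof. intros H H'. apply is_C_derive_unique in H, H'. congruence. Qed.

Lemma is_cderive_const (c z : C) : is_cderive (fun _ => c) z (RtoC 0).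
Proof. apply (@is_derive_const C_AbsRing C_NormedModule). Qed.

Lemma is_cderive_id (z : C) : is_cderive (fun w => w) z (RtoC 1).
Proof. apply is_derive_C_AbsRing. apply (@is_derive_id C_AbsRing). Qed.

Lemma is_cderive_plus (f g : C -> C) (z a b : C) :
  is_cderive f z a -> is_cderive g z b -> is_cderive (fun w => f w + g w)%C z (a + b)%C.
Proof. apply (@is_derive_plus C_AbsRing C_NormedModule). Qed.

Lemma is_cderive_minus (f g : C -> C) (z a b : C) :
  is_cderive f z a -> is_cderive g z b -> is_cderive (fun w => f w - g w)%C z (a - b)%C.
Proof. apply (@is_derive_minus C_AbsRing C_NormedModule). Qed.

Lemma is_cderive_mult (f g : C -> C) (z a b : C) :
  is_cderive f z a -> is_cderive g z b -> is_cderive (fun w => f w * g w)%C z (a * g z + f z * b)%C.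
Proof.
intros H1 H2. apply is_derive_C_AbsRing.
apply is_derive_C_AbsRing in H1. apply is_derive_C_AbsRing in H2.
apply (@is_derive_mult C_AbsRing f g z a b H1 H2 Cmult_comm).
Qed.

Lemma is_cderive_scal (c : C) (f : C -> C) (z a : C) :
  is_cderive f z a -> is_cderive (fun w => c * f w)%C z (c * a)%C.
Proof.
intros H. eapply is_cderive_eq. apply is_cderive_mult. apply is_cderive_const. apply H. simpl. ring.
Qed.

Lemma is_cderive_comp (f g : C -> C) (z a b : C) :
  is_cderive f (g z) a -> is_cderive g z b -> is_cderive (fun w => f (g w)) z (b * a)%C.
Proof.
intros H1 H2. apply is_derive_C_AbsRing in H2.
apply (@is_derive_comp C_AbsRing C_NormedModule f g z a b H1 H2).
Qed.

(** The linearization error is exactly [(w - z)^2 / (z^2 w)]. The first bound on [|w - z|] keeps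
    [|w|] above [m / 2]; the second then makes the error at most [eps |w - z|]. *)
Lemma is_cderive_inv (z : C) : z <> RtoC 0 -> is_cderive Cinv z (- / (z * z))%C.
Proof.
intros Hz. apply is_cderive_eps. intros eps He.
assert (Hm := proj1 (Cmod_gt_0 z) Hz). set (m := Cmod z) in *.
exists (Rmin (m / 2) (eps * (m * m * m) / 2)). split.
{ apply Rmin_glb_lt; [lra|]. assert (0 < m * m * m) by (repeat apply Rmult_lt_0_compat; auto). nra. }
intros w Hw.
assert (H1 := Rlt_le_trans _ _ _ Hw (Rmin_l _ _)).
assert (H2 := Rlt_le_trans _ _ _ Hw (Rmin_r _ _)).
assert (Hw2 : m / 2 < Cmod w).
{ assert (Cmod z <= Cmod w + Cmod (w - z)).
  { replace z with (w + - (w - z))%C at 1 by ring. rewrite <- (Cmod_opp (w - z)). apply Cmod_triangle. }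
  fold m in H. lra. }
assert (Hw0 : w <> RtoC 0).
{ apply Cmod_gt_0. lra. }
replace (/ w - / z - - / (z * z) * (w - z))%C with ((w - z) * (w - z) * / (z * z * w))%C
  by (field; auto).
rewrite !Cmod_mult, Cmod_inv, !Cmod_mult by (repeat apply Cmult_neq_0; auto).
fold m. rewrite (Rmult_comm eps), Rmult_assoc. apply Rmult_le_compat_l. apply Cmod_ge_0.
assert (0 < m * m) by nra.
apply Rmult_le_reg_r with (m * m * Cmod w). nra.
rewrite Rmult_assoc, Rinv_l by nra. rewrite Rmult_1_r.
apply Rlt_le in H2. eapply Rle_trans. apply H2.
replace (eps * (m * m * m) / 2) with (eps * (m * m * (m / 2))) by field.
apply Rmult_le_compat_l; [lra|]. apply Rmult_le_compat_l; lra.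
Qed.

(** Componentwise, so that the real mean value theorem, product rule and fundamental theorem of
    calculus apply directly; [is_curve_derive_eps] recovers the complex form for the chain rule. *)
Definition is_curve_derive (g : R -> C) (t : R) (d : C) : Prop :=
  is_derive (fun s => Re (g s)) t (Re d) /\ is_derive (fun s => Im (g s)) t (Im d).

Lemma is_derive_eps (f : R -> R) (x l : R) :
  is_derive f x l <->
  forall eps, 0 < eps -> exists d, 0 < d /\ forall y, Rabs (y - x) < d ->
    Rabs (f y - f x - l * (y - x)) <= eps * Rabs (y - x).
Proof.
split.
- intros [_ H] eps He.
  specialize (H x (fun P Q => Q) (mkposreal eps He)).
  destruct H as [d H]. exists d; split; [apply cond_pos|]. intros y Hy.
  specialize (H y Hy). rewrite (Rmult_comm l). exact H.
- intros H. split. apply (is_linear_scal_l l).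
  intros y Hy.
  apply (@is_filter_lim_locally_unique R_AbsRing R_NormedModule x y) in Hy. subst y.
  intros eps. destruct (H eps (cond_pos eps)) as [d [Hd H']].
  exists (mkposreal d Hd). intros y Hy. specialize (H' y Hy). rewrite (Rmult_comm l) in H'. exact H'.
Qed.

Lemma is_curve_derive_eps (g : R -> C) (t : R) (d : C) :
  is_curve_derive g t d <->
  forall eps, 0 < eps -> exists r, 0 < r /\ forall s, Rabs (s - t) < r ->
    Cmod (g s - g t - d * (s - t)) <= eps * Rabs (s - t).
Proof.
assert (ER : forall s, Re (g s - g t - d * (s - t))%C = Re (g s) - Re (g t) - Re d * (s - t))
  by (intros; unfold Re, Im; simpl; ring).
assert (EI : forall s, Im (g s - g t - d * (s - t))%C = Im (g s) - Im (g t) - Im d * (s - t))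
  by (intros; unfold Re, Im; simpl; ring).
split.
- intros [H1 H2] eps He. rewrite is_derive_eps in H1, H2.
  destruct (H1 (eps / 2)) as [r1 [Hr1 K1]]; [lra|].
  destruct (H2 (eps / 2)) as [r2 [Hr2 K2]]; [lra|].
  exists (Rmin r1 r2). split. apply Rmin_glb_lt; auto.
  intros s Hs. eapply Rle_trans. apply Cmod_le_Re_Im. rewrite ER, EI.
  specialize (K1 s (Rlt_le_trans _ _ _ Hs (Rmin_l _ _))).
  specialize (K2 s (Rlt_le_trans _ _ _ Hs (Rmin_r _ _))). lra.
- intros H. split; apply is_derive_eps; intros eps He; destruct (H eps He) as [r [Hr K]];
  exists r; split; auto; intros s Hs; eapply Rle_trans; try apply (K s Hs).
  rewrite <- ER. apply re_le_Cmod. rewrite <- EI. apply im_le_Cmod.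
Qed.

Lemma is_curve_derive_eq (g : R -> C) (t : R) (d d' : C) : is_curve_derive g t d -> d = d' -> is_curve_derive g t d'.
Proof. intros; subst; auto. Qed.

Lemma is_curve_derive_ext (f g : R -> C) (t : R) (d : C) : (forall s, f s = g s) -> is_curve_derive f t d -> is_curve_derive g t d.
Proof.
intros E [H1 H2]. split; [apply is_derive_ext with (2 := H1)|apply is_derive_ext with (2 := H2)];
  intros; rewrite E; auto.
Qed.

(** The error is that of [f] at [g t] plus [l] times that of [g], and each receives half of
    [eps]. *)
Lemma is_curve_derive_comp (f : C -> C) (g : R -> C) (t : R) (l d : C) :
  is_cderive f (g t) l -> is_curve_derive g t d -> is_curve_derive (fun s => f (g s)) t (l * d)%C.
Proof.
intros H1 H2. rewrite is_cderive_eps in H1. rewrite is_curve_derive_eps in H2. apply is_curve_derive_eps.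
intros eps He.
set (K := 1 + Cmod d). assert (HK : 0 < K) by (unfold K; generalize (Cmod_ge_0 d); lra).
set (M := 1 + Cmod l). assert (HM : 0 < M) by (unfold M; generalize (Cmod_ge_0 l); lra).
destruct (H1 (eps / 2 / K)) as [r1 [Hr1 K1]].
{ repeat apply Rdiv_lt_0_compat; lra. }
(* The entry 1 yields [|g s - g t| <= K |s - t|]; the other entry controls the error of [g] after
   multiplication by [l]. *)
destruct (H2 (Rmin 1 (eps / 2 / M))) as [r2 [Hr2 K2]].
{ apply Rmin_glb_lt; [lra|]. repeat apply Rdiv_lt_0_compat; lra. }
exists (Rmin r2 (r1 / K)). split.
{ apply Rmin_glb_lt; auto. apply Rdiv_lt_0_compat; auto. }
intros s Hs. specialize (K2 s (Rlt_le_trans _ _ _ Hs (Rmin_l _ _))).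
assert (Hs2 := Rlt_le_trans _ _ _ Hs (Rmin_r _ _)).
assert (Hab := Rabs_pos (s - t)).
assert (B : Cmod (g s - g t) <= K * Rabs (s - t)).
{ replace (g s - g t)%C with ((g s - g t - d * (s - t)) + d * (s - t))%C by ring.
  eapply Rle_trans. apply Cmod_triangle. rewrite Cmod_mult, <- RtoC_minus, Cmod_R.
  rewrite <- RtoC_minus in K2.
  assert (Rmin 1 (eps / 2 / M) <= 1) by apply Rmin_l. unfold K. nra. }
assert (B1 : Cmod (g s - g t) < r1).
{ eapply Rle_lt_trans. apply B. apply Rmult_lt_compat_l with (r := K) in Hs2; auto.
  replace (K * (r1 / K)) with r1 in Hs2 by (field; lra). auto. }
specialize (K1 (g s) B1).
replace (f (g s) - f (g t) - l * d * (s - t))%C with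
  ((f (g s) - f (g t) - l * (g s - g t)) + l * (g s - g t - d * (s - t)))%C by ring.
eapply Rle_trans. apply Cmod_triangle. rewrite Cmod_mult.
apply Rle_trans with (eps / 2 / K * (K * Rabs (s - t)) + M * (eps / 2 / M * Rabs (s - t))).
- apply Rplus_le_compat.
  + eapply Rle_trans. apply K1. apply Rmult_le_compat_l; auto.
    apply Rlt_le. repeat apply Rdiv_lt_0_compat; lra.
  + apply Rmult_le_compat; try apply Cmod_ge_0. unfold M; lra.
    eapply Rle_trans. apply K2. apply Rmult_le_compat_r; auto. apply Rmin_r.
- right. field. lra.
Qed.

Lemma is_curve_derive_const (c : C) (t : R) : is_curve_derive (fun _ => c) t (RtoC 0).
Proof. split; apply @is_derive_const. Qed.

Lemma is_curve_derive_RtoC (t : R) : is_curve_derive RtoC t (RtoC 1).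
Proof. split; unfold Re, Im; simpl. apply @is_derive_id. apply @is_derive_const. Qed.

Lemma is_curve_derive_plus (f g : R -> C) (t : R) (a b : C) :
  is_curve_derive f t a -> is_curve_derive g t b -> is_curve_derive (fun s => f s + g s)%C t (a + b)%C.
Proof.
intros [H1 H2] [H3 H4]. split.
- apply (is_derive_plus _ _ _ _ _ H1 H3).
- apply (is_derive_plus _ _ _ _ _ H2 H4).
Qed.

Lemma is_curve_derive_mult (f g : R -> C) (t : R) (a b : C) :
  is_curve_derive f t a -> is_curve_derive g t b -> is_curve_derive (fun s => f s * g s)%C t (a * g t + f t * b)%C.
Proof.
intros [H1 H2] [H3 H4]. split.
- evar_last.
  apply (is_derive_minus _ _ _ _ _ (is_derive_mult _ _ _ _ _ H1 H3 Rmult_comm)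
    (is_derive_mult _ _ _ _ _ H2 H4 Rmult_comm)).
  unfold minus, plus, opp, mult, Re, Im; simpl. ring.
- evar_last.
  apply (is_derive_plus _ _ _ _ _ (is_derive_mult _ _ _ _ _ H1 H4 Rmult_comm)
    (is_derive_mult _ _ _ _ _ H2 H3 Rmult_comm)).
  unfold minus, plus, opp, mult, Re, Im; simpl. ring.
Qed.

Lemma is_curve_derive_scal (c : C) (g : R -> C) (t : R) (d : C) :
  is_curve_derive g t d -> is_curve_derive (fun s => c * g s)%C t (c * d)%C.
Proof.
intros H. eapply is_curve_derive_eq. apply is_curve_derive_mult. apply is_curve_derive_const. apply H. simpl; ring.
Qed.

Lemma Ccontinuous_pair {T : UniformSpace} (g : T -> C) (x : T) :
  Ccontinuous g x <-> continuous (fun t => Re (g t)) x /\ continuous (fun t => Im (g t)) x.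
Proof.
split.
- intros H. split.
  + apply (continuous_comp g Re). exact H. apply continuous_fst.
  + apply (continuous_comp g Im). exact H. apply continuous_snd.
- intros [H1 H2].
  intros P HP. destruct HP as [e He].
  assert (K1 := H1 _ (locally_ball (Re (g x)) e)).
  assert (K2 := H2 _ (locally_ball (Im (g x)) e)).
  unfold filtermap in *.
  generalize (filter_and _ _ K1 K2). apply filter_imp. intros y [Y1 Y2]. apply He.
  split; auto.
Qed.

Lemma is_curve_derive_continuous (g : R -> C) (t : R) (d : C) : is_curve_derive g t d -> Ccontinuous g t.
Proof.
intros [H1 H2]. apply Ccontinuous_pair. split; apply @ex_derive_continuous; eexists; eauto.
Qed.

Lemma Ccontinuous_plus {T : UniformSpace} (f g : T -> C) (x : T) :
  Ccontinuous f x -> Ccontinuous g x -> Ccontinuous (fun t => f t + g t)%C x.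
Proof.
intros H1 H2. apply Ccontinuous_pair in H1, H2. destruct H1, H2.
apply Ccontinuous_pair; split; apply @continuous_plus; auto.
Qed.

Lemma Ccontinuous_mult {T : UniformSpace} (f g : T -> C) (x : T) :
  Ccontinuous f x -> Ccontinuous g x -> Ccontinuous (fun t => f t * g t)%C x.
Proof.
intros H1 H2. apply Ccontinuous_pair in H1, H2. destruct H1, H2.
apply Ccontinuous_pair; split.
- apply @continuous_minus; apply @continuous_mult; auto.
- apply @continuous_plus; apply @continuous_mult; auto.
Qed.

Lemma Ccontinuous_const {T : UniformSpace} (c : C) (x : T) : Ccontinuous (fun _ : T => c) x.
Proof. apply continuous_const. Qed.

Lemma Ccontinuous_comp {T : UniformSpace} (f : C -> C) (g : T -> C) (x : T) :
  Ccontinuous g x -> Ccontinuous (f : C_UniformSpace -> C) (g x) -> Ccontinuous (fun t => f (g t)) x.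
Proof. intros H1 H2. apply (continuous_comp g f); auto. Qed.

Lemma Ccontinuous_eps (f : C -> C) (z : C) :
  Ccontinuous (f : C_UniformSpace -> C) z <->
  forall eps, 0 < eps -> exists d, 0 < d /\ forall w, Cmod (w - z) < d -> Cmod (f w - f z) < eps.
Proof.
split.
- intros H eps He. apply locally_Cmod. apply (H (fun y => Cmod (y - f z) < eps)).
  apply locally_Cmod. exists eps; auto.
- intros H P HP. apply locally_Cmod in HP. destruct HP as [e [He HP]].
  apply locally_Cmod. destruct (H e He) as [d [Hd H']]. exists d; auto.
Qed.

(** * Complex power series *)

Definition is_Cseries (u : nat -> C) (l : C) : Prop :=
  is_series (fun k => Re (u k)) (Re l) /\ is_series (fun k => Im (u k)) (Im l).

Definition Cseries (u : nat -> C) : C := (Series (fun k => Re (u k)), Series (fun k => Im (u k))).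

Definition Cpseries (a : nat -> C) (z : C) : C := Cseries (fun k => a k * z ^ k)%C.

(** Absolute convergence at every smaller radius, without naming the radius of convergence: a factor
    linear in [k] is absorbed by a slightly larger radius, so the property survives differentiation
    on the same disk. *)
Definition cv_disk (Q : R) (a : nat -> C) : Prop :=
  forall r, 0 <= r < Q -> ex_series (fun k => Cmod (a k) * r ^ k).

Definition dcoef (a : nat -> C) (k : nat) : C := (INR (S k) * a (S k))%C.

Lemma is_series_zero : is_series (fun _ : nat => 0) 0.
Proof.
apply (is_lim_seq_ext (fun _ => 0) _ 0); [|apply is_lim_seq_const].
intros n. symmetry. apply (@sum_n_m_const_zero R_AbelianGroup).
Qed.

Lemma is_Cseries_unique (u : nat -> C) (l l' : C) : is_Cseries u l -> is_Cseries u l' -> l = l'.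
Proof.
intros [H1 H2] [H3 H4]. apply is_series_unique in H1, H2, H3, H4.
apply C_ext; congruence.
Qed.

Lemma Cseries_unique (u : nat -> C) (l : C) : is_Cseries u l -> Cseries u = l.
Proof. intros [H1 H2]. apply C_ext; apply is_series_unique; auto. Qed.

Lemma is_Cseries_ext (u v : nat -> C) (l : C) : (forall k, u k = v k) -> is_Cseries u l -> is_Cseries v l.
Proof.
intros E [H1 H2]; split; [apply is_series_ext with (2 := H1)|apply is_series_ext with (2 := H2)];
  intros; rewrite E; auto.
Qed.

Lemma is_Cseries_plus (u v : nat -> C) (l m : C) :
  is_Cseries u l -> is_Cseries v m -> is_Cseries (fun k => u k + v k)%C (l + m)%C.
Proof.
intros [H1 H2] [H3 H4]; split; [apply (is_series_plus _ _ _ _ H1 H3)|apply (is_series_plus _ _ _ _ H2 H4)].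
Qed.

Lemma is_Cseries_scal (c : C) (u : nat -> C) (l : C) :
  is_Cseries u l -> is_Cseries (fun k => c * u k)%C (c * l)%C.
Proof.
intros [H1 H2]; split.
- apply (is_series_minus _ _ _ _ (is_series_scal (Re c) _ _ H1) (is_series_scal (Im c) _ _ H2)).
- apply (is_series_plus _ _ _ _ (is_series_scal (Re c) _ _ H2) (is_series_scal (Im c) _ _ H1)).
Qed.

Lemma is_Cseries_incr (u : nat -> C) (l : C) :
  is_Cseries (fun k => u (S k)) (l - u O)%C <-> is_Cseries u l.
Proof.
split.
- intros [H1 H2]; split.
  + apply is_series_decr_1. exact H1.
  + apply is_series_decr_1. exact H2.
- intros [H1 H2]; split.
  + apply (is_series_incr_1 (fun k => Re (u k))). evar_last. apply H1.
    unfold plus, Re, Im; simpl; ring.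
  + apply (is_series_incr_1 (fun k => Im (u k))). evar_last. apply H2.
    unfold plus, Re, Im; simpl; ring.
Qed.

(** Both components are dominated by [v], hence the factor 2. *)
Lemma is_Cseries_abs (u : nat -> C) (v : nat -> R) :
  (forall k, Cmod (u k) <= v k) -> ex_series v ->
  is_Cseries u (Cseries u) /\ Cmod (Cseries u) <= 2 * Series v.
Proof.
intros H Hv.
assert (H1 : forall k, Rabs (Re (u k)) <= v k)
  by (intros; eapply Rle_trans; [apply re_le_Cmod|auto]).
assert (H2 : forall k, Rabs (Im (u k)) <= v k)
  by (intros; eapply Rle_trans; [apply im_le_Cmod|auto]).
split.
- split; apply Series_correct; apply (@ex_series_le _ R_CompleteNormedModule) with v; auto.
- eapply Rle_trans. apply Cmod_le_Re_Im. unfold Cseries, Re, Im; simpl fst; simpl snd.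
  assert (forall w : nat -> R, (forall k, Rabs (w k) <= v k) -> Rabs (Series w) <= Series v).
  { intros w Hw. eapply Rle_trans. apply Series_Rabs.
    apply (@ex_series_le _ R_CompleteNormedModule) with v; auto.
    intros k. unfold norm; simpl. rewrite Rabs_Rabsolu. auto.
    apply Series_le; auto. intros; split; auto. apply Rabs_pos. }
  assert (K1 := H0 _ H1). assert (K2 := H0 _ H2). unfold Re, Im in K1, K2. lra.
Qed.

Lemma Cpseries_is_Cseries (Q : R) (a : nat -> C) (z : C) :
  cv_disk Q a -> Cmod z < Q -> is_Cseries (fun k => a k * z ^ k)%C (Cpseries a z).
Proof.
intros H Hz. apply is_Cseries_abs with (fun k => Cmod (a k) * Cmod z ^ k).
- intros k. rewrite Cmod_mult, Cmod_pow. lra.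
- apply H. split; auto. apply Cmod_ge_0.
Qed.

Lemma cv_disk_le (Q : R) (a b : nat -> C) :
  (forall k, Cmod (b k) <= Cmod (a k)) -> cv_disk Q a -> cv_disk Q b.
Proof.
intros H Ha r Hr. apply (@ex_series_le _ R_CompleteNormedModule) with (2 := Ha r Hr).
intros k. unfold norm; simpl. unfold abs; simpl.
assert (0 <= r ^ k) by (apply pow_le; lra).
rewrite Rabs_pos_eq. apply Rmult_le_compat_r; auto.
apply Rmult_le_pos; auto. apply Cmod_ge_0.
Qed.

(** Bernoulli's inequality gives [k <= (1 + d)^k / d], and [d] is small enough for [r (1 + d)] to
    stay below the midpoint of [r] and [Q]. *)
Lemma INR_pow_bound (r Q : R) : 0 <= r < Q ->
  exists r' K, 0 < r' < Q /\ 0 <= K /\ r <= r' /\ forall k, INR k * r ^ k <= K * r' ^ k.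
Proof.
intros Hr. set (d := (Q - r) / (2 * Q)).
assert (Hd : 0 < d) by (apply Rdiv_lt_0_compat; lra).
assert (E : Q * d = (Q - r) / 2) by (unfold d; field; lra).
exists ((Q + r) / 2), (/ d). repeat split; try lra.
- apply Rlt_le, Rinv_0_lt_compat; auto.
- intros k. assert (P := poly k d Hd).
  assert (H1 : INR k <= / d * (1 + d) ^ k).
  { apply Rmult_le_reg_l with d; auto. rewrite <- Rmult_assoc, Rinv_r by lra. lra. }
  apply Rle_trans with (/ d * (1 + d) ^ k * r ^ k).
  + apply Rmult_le_compat_r; auto. apply pow_le; lra.
  + rewrite Rmult_assoc, <- Rpow_mult_distr. apply Rmult_le_compat_l.
    apply Rlt_le, Rinv_0_lt_compat; auto.
    apply pow_incr. split. apply Rmult_le_pos; lra. nra.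
Qed.

Lemma cv_disk_lin (Q A B : R) (a b : nat -> C) :
  (forall k, Cmod (b k) <= (A + B * INR k) * Cmod (a k)) -> cv_disk Q a -> cv_disk Q b.
Proof.
intros H Ha r Hr.
destruct (INR_pow_bound r Q Hr) as [r' [K [Hr' [HK [Hrr Hb]]]]].
apply (@ex_series_le _ R_CompleteNormedModule) with
  (fun k => (Rabs A + Rabs B * K) * (Cmod (a k) * r' ^ k)).
- intros k. unfold norm; simpl. unfold abs; simpl.
  assert (0 <= r ^ k) by (apply pow_le; lra).
  assert (r ^ k <= r' ^ k) by (apply pow_incr; lra).
  assert (C1 := Cmod_ge_0 (a k)).
  rewrite Rabs_pos_eq by (apply Rmult_le_pos; auto; apply Cmod_ge_0).
  apply Rle_trans with ((A + B * INR k) * Cmod (a k) * r ^ k).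
  + apply Rmult_le_compat_r; auto.
  + apply Rle_trans with ((Rabs A * r ^ k + Rabs B * (INR k * r ^ k)) * Cmod (a k)).
    * replace ((A + B * INR k) * Cmod (a k) * r ^ k) with ((A * r ^ k + B * (INR k * r ^ k)) * Cmod (a k)) by ring.
      apply Rmult_le_compat_r; auto. apply Rplus_le_compat; apply Rmult_le_compat_r; auto; try apply RRle_abs.
      apply Rmult_le_pos; auto. apply pos_INR.
    * replace ((Rabs A + Rabs B * K) * (Cmod (a k) * r' ^ k)) with
       ((Rabs A * r' ^ k + Rabs B * (K * r' ^ k)) * Cmod (a k)) by ring.
      apply Rmult_le_compat_r; auto. apply Rplus_le_compat; apply Rmult_le_compat_l; auto; apply Rabs_pos.
- apply (ex_series_scal (V := R_NormedModule)). apply Ha. lra.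
Qed.

Lemma cv_disk_incr (Q : R) (a : nat -> C) : cv_disk Q a -> cv_disk Q (fun k => a (S k)).
Proof.
(* The index shift divides by the radius, and [r] may be 0; the larger radius [r'] is positive. *)
intros H r Hr. set (r' := (r + Q) / 2).
apply (@ex_series_le _ R_CompleteNormedModule) with (fun k => / r' * (Cmod (a (S k)) * r' ^ (S k))).
- intros k. unfold norm; simpl. unfold abs; simpl.
  assert (0 <= r ^ k) by (apply pow_le; lra).
  assert (r ^ k <= r' ^ k) by (apply pow_incr; unfold r'; lra).
  assert (C1 := Cmod_ge_0 (a (S k))).
  rewrite Rabs_pos_eq by (apply Rmult_le_pos; auto; apply Cmod_ge_0).
  replace (/ r' * (Cmod (a (S k)) * (r' * r' ^ k))) with (Cmod (a (S k)) * r' ^ k)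
    by (field; unfold r'; lra).
  apply Rmult_le_compat_l; auto.
- apply (ex_series_scal (V := R_NormedModule)).
  apply (ex_series_incr_1 (fun k => Cmod (a k) * r' ^ k)). apply H. unfold r'; lra.
Qed.

Lemma Cmod_INR (k : nat) : Cmod (INR k) = INR k.
Proof. rewrite Cmod_R. apply Rabs_pos_eq, pos_INR. Qed.

Lemma cv_disk_INR (Q : R) (a : nat -> C) : cv_disk Q a -> cv_disk Q (fun k => INR k * a k)%C.
Proof.
apply cv_disk_lin with 0 1. intros k. rewrite Cmod_mult, Cmod_INR. right; ring.
Qed.

Lemma cv_disk_dcoef (Q : R) (a : nat -> C) : cv_disk Q a -> cv_disk Q (dcoef a).
Proof. intros H. apply (cv_disk_incr Q (fun k => INR k * a k)%C). apply cv_disk_INR; auto. Qed.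

(** The remainder of order [k + 1] is [w] times the previous one plus [(w - z)^2 (k + 1) z^k]; the
    induction closes because [k^2 + k + 1 <= (k + 1)^2]. The factor [r] on the left stands for the
    exponent [k - 1] on the right. *)
Lemma pow_taylor_bound (w z : C) (r : R) (k : nat) :
  Cmod w <= r -> Cmod z <= r ->
  r * Cmod (w ^ S k - z ^ S k - INR (S k) * z ^ k * (w - z)) <= Cmod (w - z) ^ 2 * (INR k ^ 2 * r ^ k).
Proof.
intros Hw Hz. assert (Hr : 0 <= r) by (generalize (Cmod_ge_0 w); lra).
induction k as [|k IH].
- simpl. replace (w * 1 - z * 1 - 1 * 1 * (w - z))%C with (RtoC 0) by ring.
  rewrite Cmod_0. right; ring.
- replace (w ^ S (S k) - z ^ S (S k) - INR (S (S k)) * z ^ S k * (w - z))%C with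
   (w * (w ^ S k - z ^ S k - INR (S k) * z ^ k * (w - z)) + (w - z) ^ 2 * (INR (S k) * z ^ k))%C.
  2: { rewrite !S_INR, !RtoC_plus, !Cpow_S. simpl. ring. }
  eapply Rle_trans. apply Rmult_le_compat_l; auto. apply Cmod_triangle.
  rewrite !Cmod_mult, !Cmod_pow, Cmod_INR.
  set (X := Cmod (w ^ S k - z ^ S k - INR (S k) * z ^ k * (w - z))) in *.
  assert (HX : 0 <= X) by apply Cmod_ge_0.
  set (D := Cmod (w - z) ^ 2) in *.
  assert (HD : 0 <= D) by (apply pow2_ge_0).
  assert (Hp : 0 <= r ^ k) by (apply pow_le; auto).
  assert (Cmod z ^ k <= r ^ k) by (apply pow_incr; split; auto; apply Cmod_ge_0).
  assert (HN := pos_INR k).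
  rewrite S_INR.
  apply Rle_trans with (r * (D * (INR k ^ 2 * r ^ k)) + r * (D * ((INR k + 1) * r ^ k))).
  + rewrite Rmult_plus_distr_l. apply Rplus_le_compat.
    * replace (r * (Cmod w * X)) with (Cmod w * (r * X)) by ring.
      apply Rmult_le_compat; auto. apply Cmod_ge_0. apply Rmult_le_pos; auto.
    * apply Rmult_le_compat_l; auto. apply Rmult_le_compat_l; auto.
      apply Rmult_le_compat_l; auto. lra.
  + simpl (r ^ S k).
    replace (r * (D * (INR k ^ 2 * r ^ k)) + r * (D * ((INR k + 1) * r ^ k))) with
      (D * r ^ k * r * (INR k ^ 2 + INR k + 1)) by ring.
    replace (D * ((INR k + 1) ^ 2 * (r * r ^ k))) with (D * r ^ k * r * ((INR k + 1) ^ 2)) by ring.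
    apply Rmult_le_compat_l; [|nra]. apply Rmult_le_pos; auto. apply Rmult_le_pos; auto.
Qed.

(** The termwise Taylor remainders add up to [|w - z|^2] times a series that converges at a fixed
    radius [r] strictly between [|z|] and [Q]. *)
Lemma is_cderive_Cpseries (Q : R) (a : nat -> C) (z : C) :
  cv_disk Q a -> Cmod z < Q -> is_cderive (Cpseries a) z (Cpseries (dcoef a) z).
Proof.
intros H Hz. assert (Hz0 := Cmod_ge_0 z).
set (r := (Cmod z + Q) / 2).
assert (Hr : Cmod z < r < Q) by (unfold r; lra).
assert (V : ex_series (fun k => INR k ^ 2 * Cmod (a (S k)) * r ^ k)).
{ apply ex_series_ext with (fun k => Cmod (INR k * (INR k * a (S k))) * r ^ k).
  - intros k. rewrite !Cmod_mult, Cmod_INR. simpl. ring.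
  - apply (cv_disk_INR Q (fun k => INR k * a (S k))%C); [|lra].
    apply (cv_disk_INR Q (fun k => a (S k))). apply cv_disk_incr; auto. }
set (M := Series (fun k => INR k ^ 2 * Cmod (a (S k)) * r ^ k)) in *.
assert (HM : 0 <= M).
{ replace 0 with (Series (fun _ : nat => 0)).
  - apply Series_le; auto. intros k; split; try lra.
    apply Rmult_le_pos; [apply Rmult_le_pos; [apply pow2_ge_0|apply Cmod_ge_0]|apply pow_le; lra].
  - apply is_series_unique, is_series_zero. }
apply is_cderive_eps. intros eps He.
(* The factor 2 comes from [is_Cseries_abs]; the added 1 makes [K] positive even if [M] is 0. *)
set (K := 2 * M / r + 1).
assert (HK : 0 < K).
{ unfold K. assert (0 <= 2 * M / r); [|lra]. apply Rmult_le_pos. lra.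
  apply Rlt_le, Rinv_0_lt_compat; lra. }
exists (Rmin (r - Cmod z) (eps / K)). split.
{ apply Rmin_glb_lt. lra. apply Rdiv_lt_0_compat; auto. }
intros w Hw.
assert (Hw1 := Rlt_le_trans _ _ _ Hw (Rmin_l _ _)).
assert (Hw2 := Rlt_le_trans _ _ _ Hw (Rmin_r _ _)).
assert (Hwr : Cmod w < r).
{ replace w with ((w - z) + z)%C by ring. eapply Rle_lt_trans. apply Cmod_triangle. lra. }
assert (S1 := Cpseries_is_Cseries Q a w H ltac:(lra)). apply is_Cseries_incr in S1.
assert (S2 := Cpseries_is_Cseries Q a z H ltac:(lra)). apply is_Cseries_incr in S2.
assert (S3 := Cpseries_is_Cseries Q (dcoef a) z (cv_disk_dcoef _ _ H) ltac:(lra)).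
assert (S4 := is_Cseries_plus _ _ _ _ S1 (is_Cseries_plus _ _ _ _ (is_Cseries_scal (- (1))%C _ _ S2) (is_Cseries_scal (- (w - z))%C _ _ S3))).
set (u := fun k => (a (S k) * (w ^ S k - z ^ S k - INR (S k) * z ^ k * (w - z)))%C).
apply (is_Cseries_ext _ u) in S4.
2: { intros k. unfold u, dcoef. ring. }
assert (E : (Cpseries a w - Cpseries a z - Cpseries (dcoef a) z * (w - z))%C = Cseries u).
{ rewrite (Cseries_unique _ _ S4). simpl. ring. }
rewrite E.
destruct (is_Cseries_abs u (fun k => Cmod (w - z) ^ 2 / r * (INR k ^ 2 * Cmod (a (S k)) * r ^ k))) as [_ B].
- intros k. unfold u. rewrite Cmod_mult.
  apply Rmult_le_reg_l with r. lra.
  assert (P := pow_taylor_bound w z r k ltac:(lra) ltac:(lra)).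
  replace (r * (Cmod (w - z) ^ 2 / r * (INR k ^ 2 * Cmod (a (S k)) * r ^ k))) with
    (Cmod (a (S k)) * (Cmod (w - z) ^ 2 * (INR k ^ 2 * r ^ k))) by (field; lra).
  rewrite <- Rmult_assoc, (Rmult_comm r), Rmult_assoc.
  apply Rmult_le_compat_l; auto. apply Cmod_ge_0.
- apply (ex_series_scal (V := R_NormedModule)). exact V.
- eapply Rle_trans. apply B.
  rewrite Series_scal_l. fold M.
  assert (C0 := Cmod_ge_0 (w - z)%C).
  replace (2 * (Cmod (w - z) ^ 2 / r * M)) with (2 * M / r * Cmod (w - z) * Cmod (w - z)) by (field; lra).
  apply Rmult_le_compat_r; auto.
  apply Rle_trans with (K * Cmod (w - z)). apply Rmult_le_compat_r; auto. unfold K; lra.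
  apply Rle_trans with (K * (eps / K)). apply Rmult_le_compat_l; lra. right; field; lra.
Qed.

Lemma Cpseries_ext (a b : nat -> C) (z : C) : (forall k, a k = b k) -> Cpseries a z = Cpseries b z.
Proof.
intros H. apply C_ext; apply Series_ext; intros; rewrite H; auto.
Qed.

Lemma Cpseries_0 (a : nat -> C) : Cpseries a (RtoC 0) = a O.
Proof.
apply Cseries_unique. apply is_Cseries_incr.
assert (E : forall k, (a (S k) * RtoC 0 ^ S k)%C = RtoC 0) by (intros; rewrite Cpow_S; ring).
apply is_Cseries_ext with (fun _ => RtoC 0). intros; rewrite E; auto.
replace (a O - a O * RtoC 0 ^ 0)%C with (RtoC 0) by (simpl; ring).
split; apply is_series_zero.
Qed.

(** The multiplier [c + d k] is the operator [c + d z d/dz]. Both relations of the theorem are of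
    this kind: [D] has [c = alpha] and [d = 1], the passage from [H] to [h] has [c = 1] and
    [d = 1 / (alpha + c)] with the constant of the theorem. *)
Lemma Cpseries_lin (Q : R) (a : nat -> C) (c d z : C) :
  cv_disk Q a -> Cmod z < Q ->
  Cpseries (fun k => (c + d * INR k) * a k)%C z = (c * Cpseries a z + d * (z * Cpseries (dcoef a) z))%C.
Proof.
intros H Hz. apply Cseries_unique.
assert (S2 := Cpseries_is_Cseries Q a z H Hz).
assert (S3 := is_Cseries_scal z _ _ (Cpseries_is_Cseries Q (dcoef a) z (cv_disk_dcoef _ _ H) Hz)).
assert (S4 : is_Cseries (fun k => INR k * a k * z ^ k)%C (z * Cpseries (dcoef a) z)%C).
{ apply is_Cseries_incr. simpl (INR 0). replace (z * Cpseries (dcoef a) z - 0 * a O * z ^ 0)%C with (z * Cpseries (dcoef a) z)%C by ring.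
  apply is_Cseries_ext with (2 := S3). intros k. unfold dcoef. rewrite (Cpow_S z k). ring. }
apply is_Cseries_ext with (2 := is_Cseries_plus _ _ _ _ (is_Cseries_scal c _ _ S2) (is_Cseries_scal d _ _ S4)).
intros; ring.
Qed.

Lemma cv_disk_lin_coef (Q : R) (a : nat -> C) (c d : C) :
  cv_disk Q a -> cv_disk Q (fun k => (c + d * INR k) * a k)%C.
Proof.
apply cv_disk_lin with (Cmod c) (Cmod d). intros k. rewrite Cmod_mult.
apply Rmult_le_compat_r. apply Cmod_ge_0.
eapply Rle_trans. apply Cmod_triangle. rewrite Cmod_mult, Cmod_INR. lra.
Qed.

Lemma salagean_factor_Cpseries (Q alpha : R) (a : nat -> C) (f : C -> C) (z : C) :
  cv_disk Q a -> (forall w, Cmod w < Q -> f w = Cpseries a w) -> Cmod z < Q ->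
  salagean_factor alpha f z = Cpseries (fun k => (alpha + 1 * INR k) * a k)%C z.
Proof.
intros H E Hz. unfold salagean_factor.
rewrite (Cpseries_lin Q) by auto. rewrite E by auto.
assert (D : is_cderive f z (Cpseries (dcoef a) z)).
{ apply is_cderive_disk_ext with (Cpseries a) Q; auto. intros; rewrite E; auto. apply is_cderive_Cpseries with Q; auto. }
rewrite (is_C_derive_unique _ _ _ D). ring.
Qed.

(** Convergence and equality on the whole disk go through the induction together, since each further
    [D] differentiates the previous result. *)
Lemma salagean_iter_Cpseries (Q alpha : R) (a : nat -> C) (f : C -> C) (n : nat) :
  cv_disk Q a -> (forall w, Cmod w < Q -> f w = Cpseries a w) ->
  cv_disk Q (fun k => (alpha + 1 * INR k) ^ n * a k)%C /\
  forall z, Cmod z < Q ->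
  Nat.iter n (salagean_factor alpha) f z = Cpseries (fun k => (alpha + 1 * INR k) ^ n * a k)%C z.
Proof.
intros H E. induction n as [|n [IH1 IH2]].
- split.
  + apply cv_disk_le with a; auto. intros k. simpl. rewrite Cmult_1_l. lra.
  + intros z Hz. simpl. rewrite E by auto. apply Cpseries_ext. intros; ring.
- split.
  + apply cv_disk_le with (fun k => (alpha + 1 * INR k) * ((alpha + 1 * INR k) ^ n * a k))%C.
    * intros k. rewrite Cpow_S, Cmult_assoc. lra.
    * apply cv_disk_lin_coef; auto.
  + intros z Hz. simpl Nat.iter. rewrite (salagean_factor_Cpseries Q alpha _ _ z IH1 IH2 Hz).
    apply Cpseries_ext. intros k. rewrite Cpow_S. ring.
Qed.

(** * Cauchy's formula on a circle about the origin *)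

(** [ring] and [field] apply once the equality is typed at [C] itself instead of the carrier of an
    algebraic structure. *)
Ltac ceq := match goal with |- ?a = ?b => change (@eq C a b) end.

Definition circ (rho t : R) : C := (rho * cos t, rho * sin t).

(** Integration against [dt]. On the circle [dw = i w dt], so Cauchy's kernel [dw / (i (w - z))]
    reads [w / (w - z)] and has integral [2 PI]. *)
Definition circle_int (phi : R -> C) : C :=
  (RInt (fun t => Re (phi t)) 0 (2 * PI), RInt (fun t => Im (phi t)) 0 (2 * PI)).

(** The derivative is a parameter so that its continuity can be stated: this is what differentiation
    under the integral sign uses. *)
Definition holo (Q : R) (f f' : C -> C) : Prop :=
  forall z, Cmod z < Q -> is_cderive f z (f' z) /\ Ccontinuous (f' : C_UniformSpace -> C) z.

Lemma Cmod_circ (rho t : R) : 0 <= rho -> Cmod (circ rho t) = rho.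
Proof.
intros H. unfold Cmod, circ. simpl fst; simpl snd.
replace ((rho * cos t) ^ 2 + (rho * sin t) ^ 2) with (rho ^ 2 * (Rsqr (sin t) + Rsqr (cos t))).
rewrite sin2_cos2, Rmult_1_r. apply sqrt_pow2; auto. unfold Rsqr; ring.
Qed.

Lemma circ_2PI (rho : R) : circ rho (2 * PI) = circ rho 0.
Proof. unfold circ. rewrite cos_2PI, sin_2PI, cos_0, sin_0. reflexivity. Qed.

Lemma is_curve_derive_circ (rho t : R) : is_curve_derive (circ rho) t (Ci * circ rho t)%C.
Proof.
split; unfold circ, Re, Im; simpl; auto_derive; auto; ring.
Qed.

Lemma circ_neq (rho t : R) (z : C) : Cmod z < rho -> (circ rho t - z)%C <> RtoC 0.
Proof.
intros H E. assert (C0 := Cmod_ge_0 z).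
assert (circ rho t = z).
{ replace (circ rho t) with ((circ rho t - z) + z)%C by ring. rewrite E. ring. }
assert (K := Cmod_circ rho t ltac:(lra)). rewrite H0 in K. lra.
Qed.

Lemma circ_neq_0 (rho t : R) : 0 < rho -> circ rho t <> RtoC 0.
Proof. intros H. apply Cmod_gt_0. rewrite Cmod_circ; lra. Qed.

Lemma Ccontinuous_ex_RInt (phi : R -> C) (a b : R) :
  (forall t, Ccontinuous phi t) ->
  ex_RInt (fun t => Re (phi t)) a b /\ ex_RInt (fun t => Im (phi t)) a b.
Proof.
intros H. split; apply (@ex_RInt_continuous R_CompleteNormedModule); intros t _;
  apply (proj1 (Ccontinuous_pair phi t) (H t)).
Qed.

Lemma circle_int_ext (f g : R -> C) : (forall t, f t = g t) -> circle_int f = circle_int g.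
Proof.
intros E. unfold circle_int. f_equal; apply RInt_ext; intros; rewrite E; auto.
Qed.

Lemma circle_int_plus (f g : R -> C) : (forall t, Ccontinuous f t) -> (forall t, Ccontinuous g t) ->
  circle_int (fun t => f t + g t)%C = (circle_int f + circle_int g)%C.
Proof.
intros Hf Hg. destruct (Ccontinuous_ex_RInt f 0 (2 * PI) Hf), (Ccontinuous_ex_RInt g 0 (2 * PI) Hg).
apply C_ext.
- apply (RInt_plus (V := R_CompleteNormedModule) (fun t => Re (f t)) (fun t => Re (g t))); auto.
- apply (RInt_plus (V := R_CompleteNormedModule) (fun t => Im (f t)) (fun t => Im (g t))); auto.
Qed.

Lemma circle_int_scal (c : C) (f : R -> C) : (forall t, Ccontinuous f t) ->
  circle_int (fun t => c * f t)%C = (c * circle_int f)%C.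
Proof.
intros Hf. destruct (Ccontinuous_ex_RInt f 0 (2 * PI) Hf) as [H1 H2].
apply (@RInt_correct R_CompleteNormedModule) in H1. apply (@RInt_correct R_CompleteNormedModule) in H2.
apply C_ext; apply is_RInt_unique.
- apply (is_RInt_minus _ _ _ _ _ _ (is_RInt_scal _ _ _ (Re c) _ H1) (is_RInt_scal _ _ _ (Im c) _ H2)).
- apply (is_RInt_plus _ _ _ _ _ _ (is_RInt_scal _ _ _ (Re c) _ H2) (is_RInt_scal _ _ _ (Im c) _ H1)).
Qed.

(** Each component contributes [2 PI M], hence [4 PI]. *)
Lemma circle_int_bound (f : R -> C) (M : R) : (forall t, Ccontinuous f t) ->
  (forall t, 0 <= t <= 2 * PI -> Cmod (f t) <= M) -> Cmod (circle_int f) <= 4 * PI * M.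
Proof.
intros Hf HM. destruct (Ccontinuous_ex_RInt f 0 (2 * PI) Hf) as [H1 H2].
assert (HP := PI_RGT_0).
eapply Rle_trans. apply Cmod_le_Re_Im.
assert (Rabs (Re (circle_int f)) <= (2 * PI - 0) * M).
{ apply abs_RInt_le_const; auto. lra. intros; eapply Rle_trans; [apply re_le_Cmod|auto]. }
assert (Rabs (Im (circle_int f)) <= (2 * PI - 0) * M).
{ apply abs_RInt_le_const; auto. lra. intros; eapply Rle_trans; [apply im_le_Cmod|auto]. }
lra.
Qed.

Lemma circle_int_derive (g d : R -> C) : (forall t, is_curve_derive g t (d t)) -> (forall t, Ccontinuous d t) ->
  circle_int d = (g (2 * PI)%R - g 0%R)%C.
Proof.
intros H Hc. apply C_ext; apply is_RInt_unique.
- apply (is_RInt_derive (V := R_CompleteNormedModule) (fun t => Re (g t)) (fun t => Re (d t))); intros.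
  apply (H x). apply (proj1 (Ccontinuous_pair d x) (Hc x)).
- apply (is_RInt_derive (V := R_CompleteNormedModule) (fun t => Im (g t)) (fun t => Im (d t))); intros.
  apply (H x). apply (proj1 (Ccontinuous_pair d x) (Hc x)).
Qed.

Lemma Ccontinuous_circ (rho t : R) : Ccontinuous (circ rho) t.
Proof. eapply is_curve_derive_continuous. apply is_curve_derive_circ. Qed.

Lemma Ccontinuous_inv {T : UniformSpace} (g : T -> C) (x : T) :
  Ccontinuous g x -> g x <> RtoC 0 -> Ccontinuous (fun t => / g t)%C x.
Proof.
intros H Hz. apply Ccontinuous_comp; auto. eapply is_cderive_continuous. apply is_cderive_inv; auto.
Qed.

Lemma Ccontinuous_minus {T : UniformSpace} (f g : T -> C) (x : T) :
  Ccontinuous f x -> Ccontinuous g x -> Ccontinuous (fun t => f t - g t)%C x.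
Proof.
intros H1 H2. apply Ccontinuous_pair in H1, H2. destruct H1, H2.
apply Ccontinuous_pair; split; apply @continuous_minus; auto.
Qed.

Lemma Ccontinuous_kernel (rho t : R) (z : C) : Cmod z < rho ->
  Ccontinuous (fun t => circ rho t / (circ rho t - z))%C t.
Proof.
intros H. apply Ccontinuous_mult. apply Ccontinuous_circ. apply Ccontinuous_inv.
apply Ccontinuous_minus. apply Ccontinuous_circ. apply Ccontinuous_const. apply circ_neq; auto.
Qed.

(** The segment from [z] to [w] is prolonged by the proportion [d] at both ends, so that derivatives
    in [lam] at 0 and 1 are two-sided. The modulus stays below [(1 + 2 d) rho], which is less than
    [Q]. *)
Lemma pull_to_center_bound (Q rho lam d : R) (z w : C) :
  Cmod z < rho -> rho < Q -> Cmod w = rho -> d = (Q - rho) / (2 * Q) ->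
  - d < lam < 1 + d -> Cmod (z + lam * (w - z)) < Q.
Proof.
intros Hz Hr Hw Hd Hl. assert (C0 := Cmod_ge_0 z).
assert (E : Q * d = (Q - rho) / 2) by (subst d; field; lra).
assert (D0 : 0 < d) by (subst d; apply Rdiv_lt_0_compat; lra).
replace (z + lam * (w - z))%C with ((1 - lam)%R * z + lam * w)%C.
2: { rewrite RtoC_minus. ring. }
eapply Rle_lt_trans. apply Cmod_triangle. rewrite !Cmod_mult, !Cmod_R, Hw.
unfold Rabs; destruct (Rcase_abs (1 - lam)), (Rcase_abs lam); nra.
Qed.

Section CauchyConst.
Variables (Q rho : R) (G G' : C -> C) (z : C).
Hypothesis (HG : holo Q G G') (Hz : Cmod z < rho) (Hr : rho < Q).

Let k (t : R) := (circ rho t / (circ rho t - z))%C.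
Let pt (lam t : R) := (z + lam * (circ rho t - z))%C.
Let d := (Q - rho) / (2 * Q).

Let d_pos : 0 < d.
Proof. assert (C0 := Cmod_ge_0 z). apply Rdiv_lt_0_compat; lra. Qed.

Let pt_in (lam t : R) : - d < lam < 1 + d -> Cmod (pt lam t) < Q.
Proof.
intros H. apply pull_to_center_bound with rho d; auto. apply Cmod_circ.
generalize (Cmod_ge_0 z); lra.
Qed.

Let Ccontinuous_pt (x : R * R) : Ccontinuous (fun u => pt (fst u) (snd u)) x.
Proof.
unfold pt. apply Ccontinuous_plus. apply Ccontinuous_const. apply Ccontinuous_mult.
- apply (continuous_comp fst RtoC). apply continuous_fst. eapply is_curve_derive_continuous. apply is_curve_derive_RtoC.
- apply Ccontinuous_minus. apply (continuous_comp snd (circ rho)). apply continuous_snd. apply Ccontinuous_circ.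
  apply Ccontinuous_const.
Qed.

Let is_curve_derive_lam (lam t : R) : - d < lam < 1 + d ->
  is_curve_derive (fun l => G (pt l t) * k t)%C lam (G' (pt lam t) * circ rho t)%C.
Proof.
intros H. eapply is_curve_derive_eq.
apply is_curve_derive_mult. apply is_curve_derive_comp with (f := G). apply (HG _ (pt_in _ t H)).
unfold pt. apply is_curve_derive_plus. apply is_curve_derive_const. apply is_curve_derive_mult. apply is_curve_derive_RtoC. apply is_curve_derive_const.
apply is_curve_derive_const. simpl. unfold k. field. apply circ_neq; auto.
Qed.

Let Psi (lam : R) := RInt (fun t => Re (G (pt lam t) * k t)%C) 0 (2 * PI).

Let Ccontinuous_in_t (F : C -> C) (lam t : R) :
  - d < lam < 1 + d -> (forall w, Cmod w < Q -> Ccontinuous (F : C_UniformSpace -> C) w) ->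
  Ccontinuous (fun t => F (pt lam t)) t.
Proof.
intros H HF. apply Ccontinuous_comp. 2: apply HF, pt_in; auto.
apply (continuous_comp_2 (fun _ : R => lam) (fun t => t) pt).
apply continuous_const. apply continuous_id. apply Ccontinuous_pt.
Qed.

(** The circle is contracted to [z]. Differentiating in [lam] cancels the denominator [w - z] and
    leaves the integral of [G' (z + lam (w - z)) w], which is the [t]-derivative of
    [G (z + lam (w - z)) / (lam i)]; by periodicity it vanishes. Thus [Psi] takes the same value at
    1 and 0, the two sides of Cauchy's formula. *)
Let Psi_derive (lam : R) : 0 <= lam <= 1 -> is_derive Psi lam 0.
Proof.
intros Hl. unfold Psi.
assert (HD : forall u t, - d < u < 1 + d ->
   is_derive (fun l => Re (G (pt l t) * k t)%C) u (Re (G' (pt u t) * circ rho t)%C)).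
{ intros u t Hu. apply (is_curve_derive_lam u t Hu). }
assert (Hloc : forall u, Rabs (u - lam) < d -> - d < u < 1 + d).
{ intros u Hu. apply Rabs_def2 in Hu. lra. }
evar_last.
apply is_derive_RInt_param.
- exists (mkposreal d d_pos). intros u Hu t _. eexists. apply HD. apply Hloc. exact Hu.
- intros t _.
  apply continuity_2d_pt_ext_loc with (fun u v => Re (G' (pt u v) * circ rho v)%C).
  + exists (mkposreal d d_pos). intros u v Hu _. symmetry. apply is_derive_unique. apply HD.
    apply Hloc; auto.
  + apply continuity_2d_pt_filterlim.
    refine (proj1 (proj1 (Ccontinuous_pair (fun x : R * R => (G' (pt (fst x) (snd x)) * circ rho (snd x))%C) (lam, t)) _)).
    apply Ccontinuous_mult.
    * apply Ccontinuous_comp. apply Ccontinuous_pt. apply HG. apply pt_in. simpl. lra.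
    * apply (continuous_comp snd (circ rho)). apply continuous_snd. apply Ccontinuous_circ.
- exists (mkposreal d d_pos). intros u Hu.
  refine (proj1 (Ccontinuous_ex_RInt (fun t => G (pt u t) * k t)%C 0 (2 * PI) _)).
  intros t. apply Ccontinuous_mult. apply Ccontinuous_in_t. apply Hloc; exact Hu.
  intros w Hw. eapply is_cderive_continuous. apply (HG w Hw).
  apply Ccontinuous_kernel; auto.
- transitivity (RInt (fun t => Re (G' (pt lam t) * circ rho t)%C) 0 (2 * PI)).
  { apply RInt_ext. intros t _. apply is_derive_unique, HD. lra. }
  assert (CC : forall t, Ccontinuous (fun t => G' (pt lam t) * circ rho t)%C t).
  { intros t. apply Ccontinuous_mult. apply Ccontinuous_in_t. lra. intros w Hw. apply (HG w Hw).
    apply Ccontinuous_circ. }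
  change (Re (circle_int (fun t => G' (pt lam t) * circ rho t)%C) = 0).
  (* The primitive carries a factor [1 / lam]; at 0 the integrand is [G' z] times [w], with
     primitive [G' z w / i]. *)
  destruct (Req_dec lam 0) as [L0|L0].
  + assert (E : circle_int (fun t => G' (pt lam t) * circ rho t)%C = RtoC 0).
    { rewrite (circle_int_derive (fun t => (G' z / Ci) * circ rho t)%C); auto.
      rewrite circ_2PI. ring.
      intros t. eapply is_curve_derive_eq. apply is_curve_derive_scal. apply is_curve_derive_circ.
      replace (pt lam t) with z. field. intros E; injection E; lra.
      unfold pt. rewrite L0. ring. }
    rewrite E. reflexivity.
  + assert (E : circle_int (fun t => G' (pt lam t) * circ rho t)%C = RtoC 0).
    { rewrite (circle_int_derive (fun t => / (lam * Ci) * G (pt lam t))%C); auto.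
      unfold pt. rewrite circ_2PI. ring.
      intros t. eapply is_curve_derive_eq. apply is_curve_derive_scal. apply is_curve_derive_comp with (f := G).
      apply (HG (pt lam t)). apply pt_in; lra.
      unfold pt. apply is_curve_derive_plus. apply is_curve_derive_const. apply is_curve_derive_scal.
      apply is_curve_derive_plus. apply is_curve_derive_circ. apply is_curve_derive_const with (c := (- z)%C).
      simpl. field. split. intros E; injection E; lra.
      intros E; injection E; lra. }
    rewrite E. reflexivity.
Qed.

Lemma cauchy_const_re :
  RInt (fun t => Re (G (circ rho t) * (circ rho t / (circ rho t - z)))%C) 0 (2 * PI) =
  RInt (fun t => Re (G z * (circ rho t / (circ rho t - z)))%C) 0 (2 * PI).
Proof.
assert (E : Psi 1 - Psi 0 = 0 * (1 - 0)).
{ destruct (MVT_gen Psi 0 1 (fun _ => 0)) as [c [_ Hc]]; auto.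
  - intros x Hx. rewrite Rmin_left, Rmax_right in Hx by lra. apply Psi_derive. lra.
  - intros x Hx. rewrite Rmin_left, Rmax_right in Hx by lra.
    apply continuity_pt_filterlim. apply @ex_derive_continuous. exists 0. apply Psi_derive. lra. }
transitivity (Psi 1). 2: transitivity (Psi 0); [lra|].
- apply RInt_ext. intros t _. unfold pt, k. do 3 f_equal. ring.
- apply RInt_ext. intros t _. unfold pt, k. do 3 f_equal. ring.
Qed.
End CauchyConst.

Lemma holo_scal (Q : R) (c : C) (f f' : C -> C) :
  holo Q f f' -> holo Q (fun w => c * f w)%C (fun w => c * f' w)%C.
Proof.
intros H w Hw. destruct (H w Hw). split. apply is_cderive_scal; auto.
apply Ccontinuous_mult; auto. apply Ccontinuous_const.
Qed.

(** Since [Re (- i x) = Im x], the imaginary part is the real case applied to [- i G]. *)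
Lemma cauchy_const (Q rho : R) (G G' : C -> C) (z : C) :
  holo Q G G' -> Cmod z < rho -> rho < Q ->
  circle_int (fun t => G (circ rho t) * (circ rho t / (circ rho t - z)))%C =
  circle_int (fun t => G z * (circ rho t / (circ rho t - z)))%C.
Proof.
intros HG Hz Hr. apply C_ext.
- apply (cauchy_const_re Q rho G G'); auto.
- assert (H := cauchy_const_re Q rho _ _ z (holo_scal Q (- Ci)%C _ _ HG) Hz Hr).
  unfold circle_int. simpl Im at 1 3.
  rewrite (RInt_ext _ (fun t => Im (G (circ rho t) * (circ rho t / (circ rho t - z)))%C)) in H.
  rewrite (RInt_ext (fun t => Re (- Ci * G z * _)%C) (fun t => Im (G z * (circ rho t / (circ rho t - z)))%C)) in H.
  exact H.
  + intros t _. rewrite <- Cmult_assoc. rewrite Re_mult. unfold Re at 1, Im at 1; simpl. ring.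
  + intros t _. rewrite <- Cmult_assoc. rewrite Re_mult. unfold Re at 1, Im at 1; simpl. ring.
Qed.

(** * Series expansion of Cauchy's kernel and Taylor series *)

Lemma Ccontinuous_pow {T : UniformSpace} (g : T -> C) (x : T) (n : nat) :
  Ccontinuous g x -> Ccontinuous (fun t => g t ^ n)%C x.
Proof.
intros H. induction n as [|n IH]. apply Ccontinuous_const.
apply (continuous_ext (T := T) (U := C_UniformSpace) (fun t => g t * g t ^ n)%C).
intros; reflexivity. apply Ccontinuous_mult; auto.
Qed.

Lemma sum_n_C_mult (u : nat -> C) (c : C) (n : nat) :
  (c * sum_n u n)%C = sum_n (fun k => c * u k)%C n.
Proof.
induction n. rewrite !sum_O; auto. rewrite !sum_Sn, <- IHn. unfold plus; simpl. ring.
Qed.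

Lemma is_Cseries_of_remainder (u : nat -> C) (l : C) (K q : R) :
  0 <= q < 1 -> (forall n, Cmod (l - sum_n u n) <= K * q ^ n) -> is_Cseries u l.
Proof.
intros Hq H.
assert (L : is_lim_seq (fun n => K * q ^ n) 0).
{ replace (Finite 0) with (Rbar_mult K 0) by (simpl; f_equal; ring).
  apply is_lim_seq_scal_l. apply is_lim_seq_geom. rewrite Rabs_pos_eq; lra. }
assert (A : forall (v : nat -> R) (m : R), (forall n, Rabs (sum_n v n - m) <= K * q ^ n) -> is_series v m).
{ intros v m Hv. apply (is_lim_seq_ext (fun n => (sum_n v n - m) + m) (sum_n v) m). intros n. unfold sum_n. simpl. ring.
  replace (Finite m) with (Rbar_plus 0 m) by (simpl; f_equal; ring).
  apply is_lim_seq_plus'. 2: apply is_lim_seq_const.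
  apply is_lim_seq_abs_0. apply is_lim_seq_le_le with (3 := L) (u := fun _ => 0). 2: apply is_lim_seq_const.
  intros n; split; auto. apply Rabs_pos. }
assert (SR : forall n, sum_n (fun k => Re (u k)) n = Re (sum_n u n)).
{ induction n. rewrite !sum_O; auto. rewrite !sum_Sn, IHn. reflexivity. }
assert (SI : forall n, sum_n (fun k => Im (u k)) n = Im (sum_n u n)).
{ induction n. rewrite !sum_O; auto. rewrite !sum_Sn, IHn. reflexivity. }
split; apply A; intros n; eapply Rle_trans; try apply (H n); rewrite Rabs_minus_sym.
- rewrite SR. apply (re_le_Cmod (l - sum_n u n)).
- rewrite SI. apply (im_le_Cmod (l - sum_n u n)).
Qed.

Lemma geom_kernel (w z : C) (n : nat) : w <> RtoC 0 -> (w - z)%C <> RtoC 0 ->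
  (w / (w - z))%C = (sum_n (fun k => z ^ k * (/ w) ^ k)%C n + z ^ S n * ((/ w) ^ S n * (w / (w - z))))%C.
Proof.
intros Hw Hz. induction n as [|n IH].
- rewrite sum_O. simpl. field; auto.
- rewrite sum_Sn. rewrite IH at 1. unfold plus; simpl. field; auto.
Qed.

Lemma circle_int_sum (u : nat -> R -> C) (n : nat) : (forall k t, Ccontinuous (u k) t) ->
  (forall t, Ccontinuous (fun t => sum_n (fun k => u k t) n) t) /\
  circle_int (fun t => sum_n (fun k => u k t) n) = sum_n (fun k => circle_int (u k)) n.
Proof.
intros H. induction n as [|n [IH1 IH2]].
- split. intros t. apply continuous_ext with (2 := H O t). intros; rewrite sum_O; auto.
  rewrite sum_O. apply circle_int_ext. intros; rewrite sum_O; auto.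
- split. intros t. apply (continuous_ext (T := R_UniformSpace) (U := C_UniformSpace)
    (fun t => sum_n (fun k => u k t) n + u (S n) t)%C). intros; rewrite sum_Sn; auto.
  apply Ccontinuous_plus; auto.
  rewrite sum_Sn. rewrite <- IH2. rewrite <- circle_int_plus by auto. apply circle_int_ext. intros; rewrite sum_Sn; auto.
Qed.

Lemma Cmod_circ_inv_pow (rho t : R) (k : nat) : 0 < rho -> Cmod ((/ circ rho t) ^ k) = / rho ^ k.
Proof.
intros H. rewrite Cmod_pow, Cmod_inv, Cmod_circ, pow_inv by (try apply circ_neq_0; lra). auto.
Qed.

Lemma Ccontinuous_circ_inv_pow (rho t : R) (k : nat) : 0 < rho -> Ccontinuous (fun t => (/ circ rho t) ^ k)%C t.
Proof.
intros H. apply Ccontinuous_pow. apply Ccontinuous_inv. apply Ccontinuous_circ. apply circ_neq_0; auto.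
Qed.

(** The finite geometric expansion of [geom_kernel] is integrated with its exact remainder, of order
    [(|z| / rho)^(n + 1)]; this replaces an interchange of series and integral. Only the continuity
    of [phi] on the circle enters, so the lemma serves both for [phi = 1] and for Taylor's
    series. *)
Lemma cauchy_kernel_is_Cseries (rho M : R) (phi : R -> C) (z : C) :
  (forall t, Ccontinuous phi t) -> (forall t, 0 <= t <= 2 * PI -> Cmod (phi t) <= M) -> Cmod z < rho ->
  is_Cseries (fun k => circle_int (fun t => phi t * (/ circ rho t) ^ k) * z ^ k)%C
   (circle_int (fun t => phi t * (circ rho t / (circ rho t - z))))%C.
Proof.
intros Hphi HM Hz. assert (C0 := Cmod_ge_0 z). assert (HP := PI_RGT_0).
assert (M0 : 0 <= M) by (eapply Rle_trans; [apply Cmod_ge_0|apply (HM 0); lra]).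
assert (Hk : forall k t, Ccontinuous (fun t => phi t * (/ circ rho t) ^ k)%C t).
{ intros k t. apply Ccontinuous_mult; auto. apply Ccontinuous_circ_inv_pow; lra. }
assert (Hrem : forall k t, Ccontinuous (fun t => phi t * (/ circ rho t) ^ k * (circ rho t / (circ rho t - z)))%C t).
{ intros k t. apply Ccontinuous_mult; auto. apply Ccontinuous_kernel; auto. }
set (q := Cmod z / rho).
assert (Hq : 0 <= q < 1).
{ unfold q. split. apply Rmult_le_pos; auto. apply Rlt_le, Rinv_0_lt_compat; lra.
  apply Rmult_lt_reg_r with rho. lra. unfold Rdiv; rewrite Rmult_assoc, Rinv_l; lra. }
apply is_Cseries_of_remainder with (4 * PI * M * (rho / (rho - Cmod z))) q; auto.
intros n.
assert (E : circle_int (fun t => phi t * (circ rho t / (circ rho t - z)))%C =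
  (sum_n (fun k => circle_int (fun t => phi t * (/ circ rho t) ^ k) * z ^ k) n +
  z ^ S n * circle_int (fun t => phi t * (/ circ rho t) ^ S n * (circ rho t / (circ rho t - z))))%C).
{ destruct (circle_int_sum (fun k t => z ^ k * (phi t * (/ circ rho t) ^ k))%C n) as [S1 S2].
  - intros k t. apply Ccontinuous_mult; auto. apply Ccontinuous_const.
  - rewrite (sum_n_ext _ (fun k => circle_int (fun t => z ^ k * (phi t * (/ circ rho t) ^ k))%C)).
    2: { intros k. rewrite circle_int_scal by auto. ceq; ring. }
    rewrite <- S2. rewrite <- circle_int_scal by auto. rewrite <- circle_int_plus; auto.
    2: { intros t. apply Ccontinuous_mult; auto. apply Ccontinuous_const. }
    apply circle_int_ext. intros t.
    rewrite (geom_kernel (circ rho t) z n) at 1. 2: apply circ_neq_0; lra. 2: apply circ_neq; auto.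
    rewrite (sum_n_ext (fun k => z ^ k * (phi t * (/ circ rho t) ^ k))%C (fun k => phi t * (z ^ k * (/ circ rho t) ^ k))%C).
    2: intros; ceq; ring.
    rewrite <- sum_n_C_mult. ring. }
rewrite E.
match goal with |- Cmod (?a + ?b - ?c) <= _ => replace (a + b - c)%C with b by ring end.
rewrite Cmod_mult, Cmod_pow.
apply Rle_trans with (Cmod z ^ S n * (4 * PI * (M * / rho ^ S n * (rho / (rho - Cmod z))))).
- apply Rmult_le_compat_l. apply pow_le; auto.
  apply circle_int_bound; auto. intros t Ht. rewrite !Cmod_mult, Cmod_circ_inv_pow by lra.
  assert (I0 : 0 < / rho ^ S n) by (apply Rinv_0_lt_compat, pow_lt; lra).
  apply Rmult_le_compat. apply Rmult_le_pos; [apply Cmod_ge_0|lra].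
  apply Cmod_ge_0.
  apply Rmult_le_compat_r; auto; lra.
  unfold Cdiv. rewrite Cmod_mult, Cmod_circ, Cmod_inv by (try apply circ_neq; auto; lra).
  apply Rmult_le_compat_l. lra. apply Rinv_le_contravar. lra.
  assert (T := Cmod_triangle (circ rho t - z) z).
  replace (circ rho t - z + z)%C with (circ rho t) in T by ring. rewrite Cmod_circ in T by lra. lra.
- replace (Cmod z ^ S n * (4 * PI * (M * / rho ^ S n * (rho / (rho - Cmod z))))) with
   (4 * PI * M * (rho / (rho - Cmod z)) * q ^ S n).
  2: { unfold q, Rdiv. rewrite Rpow_mult_distr, pow_inv. ring. }
  apply Rmult_le_compat_l.
  apply Rmult_le_pos. nra. apply Rlt_le, Rdiv_lt_0_compat; lra.
  simpl. assert (0 <= q ^ n) by (apply pow_le; lra). nra.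
Qed.

(** For a positive exponent, [w^(-k)] is up to a constant its own [t]-derivative, and it is
    periodic. The factor 1 matches [cauchy_kernel_is_Cseries] with [phi = 1]. *)
Lemma circle_int_circ_inv_pow (rho : R) (k : nat) : 0 < rho ->
  circle_int (fun t => RtoC 1 * (/ circ rho t) ^ k)%C = match k with O => RtoC (2 * PI) | _ => RtoC 0 end.
Proof.
intros H. destruct k as [|k].
- rewrite (circle_int_derive (fun t => RtoC t)). ring.
  intros t. eapply is_curve_derive_eq. apply is_curve_derive_RtoC. simpl; ring.
  intros t. apply Ccontinuous_mult. apply Ccontinuous_const. apply Ccontinuous_const.
- rewrite (circle_int_derive (fun t => - / (INR (S k) * Ci) * (/ circ rho t) ^ S k)%C).
  rewrite circ_2PI. ring.
  2: { intros t. apply Ccontinuous_mult. apply Ccontinuous_const. apply Ccontinuous_circ_inv_pow; auto. }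
  intros t.
  assert (HI : is_curve_derive (fun t => / circ rho t)%C t (- Ci * / circ rho t)%C).
  { eapply is_curve_derive_eq. apply is_curve_derive_comp with (f := Cinv). apply is_cderive_inv. apply circ_neq_0; auto. apply is_curve_derive_circ.
    field. apply circ_neq_0; auto. }
  assert (HP : forall j, is_curve_derive (fun t => (/ circ rho t) ^ j)%C t (- INR j * Ci * (/ circ rho t) ^ j)%C).
  { induction j as [|j IHj]. apply (is_curve_derive_eq (fun _ => RtoC 1) t (RtoC 0)). apply is_curve_derive_const. simpl; ring.
    apply is_curve_derive_ext with (fun t => / circ rho t * (/ circ rho t) ^ j)%C. intros; reflexivity.
    eapply is_curve_derive_eq. apply is_curve_derive_mult. apply HI. apply IHj. rewrite S_INR, RtoC_plus. simpl. ring. }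
  eapply is_curve_derive_eq. apply is_curve_derive_scal. apply HP. field. split.
  intros E; injection E; lra.
  intros E. apply RtoC_inj in E. apply (not_0_INR (S k)); auto.
Qed.

Lemma circle_int_kernel (rho : R) (z : C) : Cmod z < rho ->
  circle_int (fun t => circ rho t / (circ rho t - z))%C = RtoC (2 * PI).
Proof.
intros Hz. assert (C0 := Cmod_ge_0 z).
assert (H := cauchy_kernel_is_Cseries rho 1 (fun _ => RtoC 1) z ltac:(intros; apply Ccontinuous_const)
  ltac:(intros; cbv beta; rewrite Cmod_1; lra) Hz). cbv beta in H.
rewrite (circle_int_ext _ (fun t => circ rho t / (circ rho t - z))%C) in H by (intros; ring).
apply is_Cseries_unique with (1 := H). apply is_Cseries_incr.
rewrite circle_int_circ_inv_pow by lra.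
replace (RtoC (2 * PI) - RtoC (2 * PI) * z ^ 0)%C with (RtoC 0) by (simpl; ring).
apply is_Cseries_ext with (fun _ => RtoC 0). intros k. rewrite circle_int_circ_inv_pow by lra. ring.
split; apply is_series_zero.
Qed.

Lemma cauchy_formula (Q rho : R) (G G' : C -> C) (z : C) :
  holo Q G G' -> Cmod z < rho -> rho < Q ->
  circle_int (fun t => G (circ rho t) * (circ rho t / (circ rho t - z)))%C = (RtoC (2 * PI) * G z)%C.
Proof.
intros HG Hz Hr. rewrite (cauchy_const Q rho G G' z HG Hz Hr).
rewrite circle_int_scal by (intros; apply Ccontinuous_kernel; auto).
rewrite circle_int_kernel by auto. ring.
Qed.

Lemma Ccontinuous_bounded (phi : R -> C) (a b : R) : a <= b -> (forall t, Ccontinuous phi t) ->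
  exists M, forall t, a <= t <= b -> Cmod (phi t) <= M.
Proof.
intros Hab H.
destruct (continuity_ab_maj (fun t => Rabs (Re (phi t)) + Rabs (Im (phi t))) a b Hab) as [m [Hm _]].
- intros t _. apply continuity_pt_filterlim.
  apply (continuous_plus (fun t => Rabs (Re (phi t))) (fun t => Rabs (Im (phi t)))).
  + apply (continuous_comp (fun t => Re (phi t)) Rabs); [|apply continuous_Rabs].
    apply (proj1 (Ccontinuous_pair phi t) (H t)).
  + apply (continuous_comp (fun t => Im (phi t)) Rabs); [|apply continuous_Rabs].
    apply (proj1 (Ccontinuous_pair phi t) (H t)).
- eexists. intros t Ht. eapply Rle_trans. apply Cmod_le_Re_Im. apply (Hm t Ht).
Qed.

Lemma holo_continuous (Q : R) (f f' : C -> C) (z : C) :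
  holo Q f f' -> Cmod z < Q -> Ccontinuous (f : C_UniformSpace -> C) z.
Proof. intros H Hz. eapply is_cderive_continuous. apply (H z Hz). Qed.

Lemma holo_le (Q Q2 : R) (f f' : C -> C) : Q2 <= Q -> holo Q f f' -> holo Q2 f f'.
Proof. intros H Hf z Hz. apply Hf. lra. Qed.

Lemma holo_circ_continuous (Q rho : R) (f f' : C -> C) : holo Q f f' -> 0 <= rho < Q ->
  forall t, Ccontinuous (fun t => f (circ rho t)) t.
Proof.
intros H Hr t. apply Ccontinuous_comp. apply Ccontinuous_circ.
apply (holo_continuous Q f f'); auto. rewrite Cmod_circ; lra.
Qed.

Lemma holo_mult (Q : R) (f f' g g' : C -> C) :
  holo Q f f' -> holo Q g g' ->
  holo Q (fun w => f w * g w)%C (fun w => f' w * g w + f w * g' w)%C.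
Proof.
intros Hf Hg z Hz. assert (F := holo_continuous _ _ _ _ Hf Hz).
assert (G := holo_continuous _ _ _ _ Hg Hz).
destruct (Hf z Hz), (Hg z Hz). split. apply is_cderive_mult; auto.
apply Ccontinuous_plus; apply Ccontinuous_mult; auto.
Qed.

Lemma holo_Cpseries (Q : R) (a : nat -> C) : cv_disk Q a -> holo Q (Cpseries a) (Cpseries (dcoef a)).
Proof.
intros H z Hz. split. apply is_cderive_Cpseries with Q; auto.
eapply is_cderive_continuous. apply is_cderive_Cpseries with Q; auto. apply cv_disk_dcoef; auto.
Qed.

Lemma cv_disk_geom (rho K : R) (a : nat -> C) : 0 < rho ->
  (forall k, Cmod (a k) <= K / rho ^ k) -> cv_disk rho a.
Proof.
intros Hr H r Hrr.
apply (@ex_series_le _ R_CompleteNormedModule) with (fun k => K * (r / rho) ^ k).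
- intros k. unfold norm; simpl. unfold abs; simpl.
  assert (0 <= r ^ k) by (apply pow_le; lra).
  rewrite Rabs_pos_eq by (apply Rmult_le_pos; auto; apply Cmod_ge_0).
  apply Rle_trans with (K / rho ^ k * r ^ k). apply Rmult_le_compat_r; auto.
  right. unfold Rdiv. rewrite Rpow_mult_distr, pow_inv. ring.
- apply (ex_series_scal (V := R_NormedModule)). apply ex_series_geom.
  rewrite Rabs_pos_eq.
  apply Rmult_lt_reg_r with rho. lra. unfold Rdiv; rewrite Rmult_assoc, Rinv_l; lra.
  apply Rmult_le_pos. lra. apply Rlt_le, Rinv_0_lt_compat; lra.
Qed.

(** The coefficients are Cauchy's integrals over the circle of radius [rho], which must lie inside
    the disk of [holo]; hence a smaller radius in the conclusion. *)
Lemma holo_power_series (Q rho : R) (f f' : C -> C) : holo Q f f' -> 0 < rho < Q ->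
  exists a, cv_disk rho a /\ forall z, Cmod z < rho -> f z = Cpseries a z.
Proof.
intros Hf Hr. assert (HP := PI_RGT_0).
assert (Hc := holo_circ_continuous Q rho f f' Hf ltac:(lra)).
destruct (Ccontinuous_bounded _ 0 (2 * PI) ltac:(lra) Hc) as [M HM].
exists (fun k => / RtoC (2 * PI) * circle_int (fun t => f (circ rho t) * (/ circ rho t) ^ k))%C.
assert (P0 : RtoC (2 * PI) <> RtoC 0) by (intros E; apply RtoC_inj in E; lra).
split.
(* The 2 is the [4 PI] of [circle_int_bound] over the normalization [2 PI]. *)
- apply cv_disk_geom with (2 * M). lra. intros k.
  rewrite Cmod_mult, Cmod_inv, Cmod_R, Rabs_pos_eq by (auto; lra).
  apply Rmult_le_reg_l with (2 * PI). lra. rewrite <- Rmult_assoc, Rinv_r, Rmult_1_l by lra.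
  eapply Rle_trans. apply circle_int_bound with (M := M * / rho ^ k).
  + intros t. apply Ccontinuous_mult; auto. apply Ccontinuous_circ_inv_pow; lra.
  + intros t Ht. rewrite Cmod_mult, Cmod_circ_inv_pow by lra.
    apply Rmult_le_compat_r. apply Rlt_le, Rinv_0_lt_compat, pow_lt; lra. apply HM; auto.
  + right. unfold Rdiv; ring.
- intros z Hz. symmetry. apply Cseries_unique.
  assert (S := cauchy_kernel_is_Cseries rho M (fun t => f (circ rho t)) z Hc HM Hz). cbv beta in S.
  rewrite (cauchy_formula Q rho f f' z) in S by (auto; lra).
  replace (f z) with (/ RtoC (2 * PI) * (RtoC (2 * PI) * f z))%C by (field; auto).
  apply is_Cseries_ext with (2 := is_Cseries_scal (/ RtoC (2 * PI))%C _ _ S). intros k. ring.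
Qed.

Lemma Ccontinuous_id (z : C) : Ccontinuous (fun w : C_UniformSpace => w) z.
Proof. apply continuous_id. Qed.

Lemma Cmod_sqr (z : C) : RtoC (Cmod z ^ 2) = (z * Cconj z)%C.
Proof. rewrite <- Cmod2_conj. reflexivity. Qed.

(** * Poisson and Harnack *)

(** On [|w| = rho] this function is the conjugate of [z / (w - z)], because [rho^2 = w conj w]. Its
    pole is the reflected point [rho^2 / conj z], outside the disk of radius [Q], and it vanishes at
    0. *)
Lemma holo_reflected_kernel (rho Q : R) (z : C) : Cmod z * Q < rho ^ 2 ->
  holo Q (fun w => Cconj z * w * / (RtoC (rho ^ 2) - Cconj z * w))%C
    (fun w => RtoC (rho ^ 2) * Cconj z * / ((RtoC (rho ^ 2) - Cconj z * w) * (RtoC (rho ^ 2) - Cconj z * w)))%C.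
Proof.
intros HQ w Hw.
assert (N : (RtoC (rho ^ 2) - Cconj z * w)%C <> RtoC 0).
{ intros E. assert (E' : RtoC (rho ^ 2) = (Cconj z * w)%C).
  { replace (RtoC (rho ^ 2)) with ((RtoC (rho ^ 2) - Cconj z * w) + Cconj z * w)%C by ring.
    rewrite E; ring. }
  apply (f_equal Cmod) in E'. rewrite Cmod_mult, Cmod_conj, Cmod_R in E'.
  rewrite Rabs_pos_eq in E' by apply pow2_ge_0.
  assert (Cmod z * Cmod w <= Cmod z * Q). { apply Rmult_le_compat_l. apply Cmod_ge_0. lra. } lra. }
split.
- eapply is_cderive_eq. apply is_cderive_mult. apply is_cderive_scal. apply is_cderive_id.
  apply (is_cderive_comp Cinv). apply is_cderive_inv; auto. apply is_cderive_minus. apply is_cderive_const. apply is_cderive_scal. apply is_cderive_id.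
  simpl. field. auto.
- apply Ccontinuous_mult. apply Ccontinuous_const. apply Ccontinuous_inv. 2: apply Cmult_neq_0; auto.
  apply Ccontinuous_mult; apply Ccontinuous_minus; try apply Ccontinuous_const;
  apply Ccontinuous_mult; try apply Ccontinuous_const; apply Ccontinuous_id.
Qed.

Definition poisson (rho : R) (z : C) (t : R) : R :=
  (rho ^ 2 - Cmod z ^ 2) / Cmod (circ rho t - z) ^ 2.

Lemma poisson_kernel_split (rho t : R) (z : C) : Cmod z < rho ->
  RtoC (poisson rho z t) = (circ rho t / (circ rho t - z) +
    Cconj z * circ rho t * / (RtoC (rho ^ 2) - Cconj z * circ rho t))%C.
Proof.
intros Hz. assert (C0 := Cmod_ge_0 z).
assert (N := circ_neq rho t z Hz).
assert (N0 := circ_neq_0 rho t ltac:(lra)).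
assert (Nm := proj1 (Cmod_gt_0 _) N).
unfold poisson. rewrite RtoC_div by (apply pow_nonzero; lra).
rewrite RtoC_minus, !Cmod_sqr.
assert (E : RtoC (rho ^ 2) = (circ rho t * Cconj (circ rho t))%C).
{ rewrite <- Cmod_sqr, Cmod_circ by lra. reflexivity. }
rewrite E. rewrite Cminus_conj.
assert (NC : (Cconj (circ rho t) - Cconj z)%C <> RtoC 0).
{ rewrite <- Cminus_conj. intros H. apply N. rewrite <- (Cconj_conj (circ rho t - z)), H.
  apply C_ext; unfold Re, Im; simpl; ring. }
field. split; auto.
replace (circ rho t * Cconj (circ rho t) - Cconj z * circ rho t)%C with
 (circ rho t * (Cconj (circ rho t) - Cconj z))%C by ring. apply Cmult_neq_0; auto.
Qed.

(** Poisson's kernel is Cauchy's kernel plus the reflected one. The first part gives [P z]; [P]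
    times the reflected kernel is holomorphic across the circle and vanishes at 0, so Cauchy's
    formula at the origin makes the second part contribute 0. *)
Lemma poisson_formula (Q rho : R) (P P' : C -> C) (z : C) :
  holo Q P P' -> Cmod z < rho -> rho < Q ->
  is_RInt (fun t => Re (P (circ rho t)) * poisson rho z t) 0 (2 * PI) (2 * PI * Re (P z)).
Proof.
intros HP Hz Hr. assert (C0 := Cmod_ge_0 z).
assert (R0 : 0 < rho) by lra.
(* For [z <> 0] the second entry is the harmonic mean of [rho] and of the modulus [rho^2 / |z|] of
   the reflected pole, hence strictly between them; in this form it also makes sense at [z = 0]. *)
set (Q1 := Rmin Q (2 * rho ^ 2 / (rho + Cmod z))).
assert (E0 : 2 * rho ^ 2 / (rho + Cmod z) * (rho + Cmod z) = 2 * rho ^ 2) by (field; lra).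
assert (HQ1 : rho < Q1).
{ apply Rmin_glb_lt; auto. apply Rmult_lt_reg_r with (rho + Cmod z). lra. rewrite E0. nra. }
assert (HQ2 : Cmod z * Q1 < rho ^ 2).
{ apply Rle_lt_trans with (Cmod z * (2 * rho ^ 2 / (rho + Cmod z))).
  apply Rmult_le_compat_l; auto. apply Rmin_r.
  apply Rmult_lt_reg_r with (rho + Cmod z). lra. rewrite Rmult_assoc, E0.
  assert (0 < rho ^ 2 * (rho - Cmod z)) by (apply Rmult_lt_0_compat; [apply pow_lt|]; lra). nra. }
assert (HG := holo_mult Q1 _ _ _ _ (holo_le Q Q1 _ _ (Rmin_l _ _) HP) (holo_reflected_kernel rho Q1 z HQ2)).
assert (I1 := cauchy_formula Q rho P P' z HP Hz Hr).
assert (I2 := cauchy_formula Q1 rho _ _ (RtoC 0) HG ltac:(rewrite Cmod_0; lra) HQ1).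
cbv beta in I2.
assert (E : circle_int (fun t => P (circ rho t) * RtoC (poisson rho z t))%C = (RtoC (2 * PI) * P z)%C).
(* The added 0 is then written as [2 PI] times the value at the origin of [P] times the reflected
   kernel. *)
{ rewrite <- (Cplus_0_r (_ * P z)).
  replace (RtoC 0) with (RtoC (2 * PI) * (P (RtoC 0) * (Cconj z * RtoC 0 * / (RtoC (rho ^ 2) - Cconj z * RtoC 0))))%C by ring.
  rewrite <- I1, <- I2. rewrite <- circle_int_plus.
  - apply circle_int_ext. intros t. rewrite poisson_kernel_split by auto.
    assert (N0 := circ_neq_0 rho t ltac:(lra)).
    replace (circ rho t / (circ rho t - 0))%C with (RtoC 1).
    ring. replace (circ rho t - 0)%C with (circ rho t) by ring. field; auto.
  - intros t. apply Ccontinuous_mult. apply (holo_circ_continuous Q rho P P'); auto; lra. apply Ccontinuous_kernel; auto.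
  - intros t. apply Ccontinuous_mult. apply (holo_circ_continuous Q1 rho _ _ HG); auto; lra.
    apply Ccontinuous_kernel; rewrite Cmod_0; lra. }
assert (K : forall t, Ccontinuous (fun t => P (circ rho t) * RtoC (poisson rho z t))%C t).
{ intros t. apply (continuous_ext (T := R_UniformSpace) (U := C_UniformSpace) (fun t => P (circ rho t) * (circ rho t / (circ rho t - z) +
    Cconj z * circ rho t * / (RtoC (rho ^ 2) - Cconj z * circ rho t)))%C).
  intros s; rewrite poisson_kernel_split; auto.
  apply Ccontinuous_mult. apply (holo_circ_continuous Q rho P P'); auto; lra.
  apply Ccontinuous_plus. apply Ccontinuous_kernel; auto.
  apply (holo_circ_continuous Q1 rho _ _ (holo_reflected_kernel rho Q1 z HQ2)); lra. }
destruct (Ccontinuous_ex_RInt _ 0 (2 * PI) K) as [X _].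
apply (@RInt_correct R_CompleteNormedModule) in X.
apply (f_equal Re) in E.
replace (2 * PI * Re (P z)) with (Re (RtoC (2 * PI) * P z)%C) by (rewrite Re_mult; unfold Re, Im, RtoC; simpl; ring).
rewrite <- E. apply is_RInt_ext with (2 := X). intros t _. rewrite Re_mult. unfold Re, Im, RtoC; simpl; ring.
Qed.

(* The difference of the two sides is affine in [c = Re (w * conj e) >= - rho] and vanishes at [c = - rho]. *)
Lemma harnack_kernel_mono (rho s s' : R) (e w : C) :
  Cmod e = 1 -> Cmod w = rho -> 0 <= s <= s' -> s' < rho ->
  (rho + s) ^ 2 * Cmod (w - s' * e) ^ 2 <= (rho + s') ^ 2 * Cmod (w - s * e) ^ 2.
Proof.
intros He Hw Hs Hs'.
assert (E2 : Re e ^ 2 + Im e ^ 2 = 1) by (rewrite <- Cmod2_alt, He; ring).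
assert (W2 : Re w ^ 2 + Im w ^ 2 = rho ^ 2) by (rewrite <- Cmod2_alt, Hw; ring).
set (c := Re w * Re e + Im w * Im e).
assert (X : forall x : R, Cmod (w - x * e) ^ 2 = rho ^ 2 + x ^ 2 - 2 * x * c).
{ intros x. rewrite Cmod2_alt. replace (Re (w - x * e)%C) with (Re w - x * Re e) by (unfold Re, Im; simpl; ring).
  replace (Im (w - x * e)%C) with (Im w - x * Im e) by (unfold Re, Im; simpl; ring).
  transitivity (Re w ^ 2 + Im w ^ 2 + x ^ 2 * (Re e ^ 2 + Im e ^ 2) - 2 * x * c).
  unfold c; ring. rewrite E2, W2; ring. }
rewrite !X.
assert (Hc : - rho <= c).
(* Cauchy-Schwarz in the plane, through Lagrange's identity. *)
{ assert (c ^ 2 <= rho ^ 2).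
  { rewrite <- (Rmult_1_r (rho ^ 2)), <- W2, <- E2. unfold c.
    generalize (pow2_ge_0 (Re w * Im e - Im w * Re e)). nra. }
  nra. }
assert (0 <= (c + rho) * (2 * (s' - s) * (rho ^ 2 - s * s'))).
{ apply Rmult_le_pos. lra. apply Rmult_le_pos. lra. nra. }
nra.
Qed.

(** After multiplication by [(rho + x) / (rho - x)], the kernel at [x e] is
    [(rho + x)^2 / |w - x e|^2]. By [harnack_kernel_mono] it is monotone in [x] pointwise on the
    circle, and the weight [Re (P w)] is positive. *)
Lemma harnack_mono (Q rho s s' : R) (P P' : C -> C) (e : C) :
  holo Q P P' -> (forall w, Cmod w < Q -> 0 < Re (P w)) -> Cmod e = 1 ->
  0 <= s <= s' -> s' < rho -> rho < Q ->
  Re (P (s * e)%C) * ((rho + s) / (rho - s)) <= Re (P (s' * e)%C) * ((rho + s') / (rho - s')).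
Proof.
intros HP Hpos He Hs Hs' Hr. assert (HPI := PI_RGT_0).
assert (M : forall x : R, 0 <= x -> Cmod (x * e) = x).
{ intros x Hx. rewrite Cmod_mult, He, Cmod_R, Rabs_pos_eq; lra. }
assert (I := fun x H1 H2 => is_RInt_scal _ _ _ ((rho + x) / (rho - x)) _
  (poisson_formula Q rho P P' (x * e)%C HP (eq_ind_r (fun y => y < rho) H2 (M x H1)) Hr)).
apply Rmult_le_reg_l with (2 * PI). lra.
assert (L := is_RInt_le _ _ _ _ _ _ (ltac:(lra) : 0 <= 2 * PI) (I s ltac:(lra) ltac:(lra)) (I s' ltac:(lra) ltac:(lra))).
unfold scal in L; simpl in L; unfold mult in L; simpl in L.
assert (L2 : forall x y, x <= y -> x = 2 * PI * (Re (P (s * e)%C) * ((rho + s) / (rho - s))) ->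
  y = 2 * PI * (Re (P (s' * e)%C) * ((rho + s') / (rho - s'))) -> 2 * PI * (Re (P (s * e)%C) * ((rho + s) / (rho - s))) <= 2 * PI * (Re (P (s' * e)%C) * ((rho + s') / (rho - s')))) by (intros; lra).
eapply L2. apply L. 2: ring. 2: ring.
intros t _.
set (w := circ rho t). assert (Hw : Cmod w = rho) by (apply Cmod_circ; lra).
assert (Pw : 0 < Re (P w)) by (apply Hpos; lra).
assert (K := harnack_kernel_mono rho s s' e w He Hw Hs Hs').
unfold poisson. fold w. rewrite !M by lra.
assert (B : forall x : R, 0 <= x < rho -> 0 < Cmod (w - x * e) ^ 2).
{ intros x Hx. apply pow_lt. apply Cmod_gt_0. apply circ_neq. rewrite M; lra. }
assert (B1 := B s ltac:(lra)). assert (B2 := B s' ltac:(lra)).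
replace ((rho + s) / (rho - s) * (Re (P w) * ((rho ^ 2 - s ^ 2) / Cmod (w - s * e) ^ 2))) with
  (Re (P w) * ((rho + s) ^ 2 / Cmod (w - s * e) ^ 2)) by (field; split; [intros Z; rewrite Z in B1; simpl in B1; lra|lra]).
replace ((rho + s') / (rho - s') * (Re (P w) * ((rho ^ 2 - s' ^ 2) / Cmod (w - s' * e) ^ 2))) with
  (Re (P w) * ((rho + s') ^ 2 / Cmod (w - s' * e) ^ 2)) by (field; split; [intros Z; rewrite Z in B2; simpl in B2; lra|lra]).
apply Rmult_le_compat_l. lra.
apply Rmult_le_reg_r with (Cmod (w - s * e) ^ 2 * Cmod (w - s' * e) ^ 2). apply Rmult_lt_0_compat; auto.
field_simplify; [lra| |]; intros Z; rewrite Z in *; simpl in *; lra.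
Qed.

Lemma is_derive_mono_ge_0 (f : R -> R) (x l d : R) : 0 < d ->
  is_derive f x l -> (forall y, x <= y < x + d -> f x <= f y) -> 0 <= l.
Proof.
intros Hd H Hm. destruct (Rle_dec 0 l) as [|N]; auto. exfalso.
rewrite is_derive_eps in H. destruct (H (- l / 2)) as [r [Hr K]]. lra.
set (h := Rmin r d / 2). assert (0 < Rmin r d) by (apply Rmin_glb_lt; auto).
assert (Rmin r d <= r) by apply Rmin_l. assert (Rmin r d <= d) by apply Rmin_r.
specialize (K (x + h)). specialize (Hm (x + h)).
replace (x + h - x) with h in K by ring.
rewrite (Rabs_pos_eq h) in K by (unfold h; lra).
specialize (K ltac:(unfold h; lra)). specialize (Hm ltac:(unfold h; lra)).
apply Rabs_le_between in K. assert (0 < h) by (unfold h; lra). nra.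
Qed.

Lemma harnack_derivative (Q rho : R) (P P' : C -> C) (z : C) :
  holo Q P P' -> (forall w, Cmod w < Q -> 0 < Re (P w)) -> Cmod z < rho -> rho < Q ->
  0 <= Re (z * P' z)%C * (rho ^ 2 - Cmod z ^ 2) + 2 * rho * Cmod z * Re (P z).
Proof.
intros HP Hpos Hz Hr.
(* The direction [e = z / |z|] is undefined at the origin, where both terms vanish. *)
destruct (Req_dec (Cmod z) 0) as [Z|Z].
{ rewrite (Cmod_eq_0 z Z), Cmod_0. rewrite Cmult_0_l. unfold Re at 1; simpl. lra. }
assert (C0 := Cmod_ge_0 z). set (s := Cmod z) in *.
set (e := (z / s)%C).
assert (S0 : RtoC s <> RtoC 0) by (intros E; apply RtoC_inj in E; auto).
assert (Ez : z = (s * e)%C) by (unfold e; field; auto).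
assert (He : Cmod e = 1).
{ unfold e. rewrite Cmod_div by auto. rewrite Cmod_R, Rabs_pos_eq by lra. unfold s; field; auto. }
assert (D : is_curve_derive (fun x : R => P (x * e)%C) s (P' z * e)%C).
{ eapply is_curve_derive_eq. apply is_curve_derive_comp with (f := P). rewrite <- Ez. apply (HP z). fold s; lra.
  apply is_curve_derive_mult. apply is_curve_derive_RtoC. apply is_curve_derive_const. cbv beta; ring. }
destruct D as [D _].
assert (D2 : is_derive (fun x => (rho + x) / (rho - x)) s (2 * rho / (rho - s) ^ 2)).
{ auto_derive. lra. field. lra. }
assert (D3 := is_derive_mult _ _ _ _ _ D D2 Rmult_comm).
set (V := Re (P' z * e)%C) in *.
apply (is_derive_mono_ge_0 _ s _ (rho - s)) in D3; [|lra|].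
2: { intros y Hy. apply (harnack_mono Q rho s y P P' e); auto; lra. }
unfold plus, mult in D3; simpl in D3. rewrite <- Ez in D3.
assert (E : Re (z * P' z)%C = s * V).
{ unfold V. rewrite Ez at 1. rewrite !Re_mult, !Im_mult. unfold RtoC; unfold Re at 2, Im at 3; simpl. unfold Re, Im; simpl. ring. }
rewrite E.
(* The factor [s] turns the radial derivative into [Re (z P')]; the square clears the
   denominators. *)
apply Rmult_le_compat_r with (r := s * (rho - s) ^ 2) in D3.
2: { apply Rmult_le_pos; auto. apply pow2_ge_0. }
rewrite Rmult_0_l in D3. eapply Rle_trans. apply D3. right. field. lra.
Qed.

(** * The radius r0 *)

(** Harnack's lower bound for [Re (z P')] is proportional to [Re P], so the sum is at least [Re P]
    times a factor that the last hypothesis makes positive. *)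
Lemma re_pos_transfer (Q rho a : R) (P P' : C -> C) (z : C) : 0 < a ->
  holo Q P P' -> (forall w, Cmod w < Q -> 0 < Re (P w)) -> Cmod z < rho -> rho < Q ->
  2 * rho * Cmod z < a * (rho ^ 2 - Cmod z ^ 2) ->
  0 < Re (P z) + / a * Re (z * P' z)%C.
Proof.
intros Ha HP Hpos Hz Hr Hs. assert (C0 := Cmod_ge_0 z).
assert (D := harnack_derivative Q rho P P' z HP Hpos Hz Hr).
assert (U := Hpos z ltac:(lra)).
set (X := Re (z * P' z)%C) in *. set (u := Re (P z)) in *.
set (d := rho ^ 2 - Cmod z ^ 2) in *.
assert (Hd : 0 < d) by (unfold d; nra).
apply Rmult_lt_reg_r with (a * d). apply Rmult_lt_0_compat; auto.
replace ((u + / a * X) * (a * d)) with (u * (a * d) + X * d) by (field; lra).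
assert (0 < u * (a * d - 2 * rho * Cmod z)) by (apply Rmult_lt_0_compat; lra). lra.
Qed.

(** [r0] is the positive root of [a r^2 + 2 r - a], the equality case at [rho = 1] of the condition
    in [re_pos_transfer]. *)
Lemma r0_root (alpha c : R) : 0 < alpha + c ->
  0 < r0 alpha c < 1 /\ 2 * r0 alpha c = (alpha + c) * (1 - r0 alpha c ^ 2).
Proof.
intros H. unfold r0. set (a := alpha + c) in *.
set (t := sqrt (1 + a ^ 2)).
assert (T2 : t ^ 2 = 1 + a ^ 2) by (apply pow2_sqrt; nra).
assert (T1 : 1 < t).
{ unfold t. rewrite <- sqrt_1 at 1. apply sqrt_lt_1; nra. }
assert (T3 : t < 1 + a) by nra.
repeat split.
- apply Rdiv_lt_0_compat; lra.
- apply Rmult_lt_reg_r with a; auto. unfold Rdiv. rewrite Rmult_assoc, Rinv_l; lra.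
- apply Rmult_eq_reg_r with a; [|lra].
  replace (2 * ((t - 1) / a) * a) with (2 * (t - 1)) by (field; lra).
  replace (a * (1 - ((t - 1) / a) ^ 2) * a) with (a ^ 2 - (t - 1) ^ 2) by (field; lra).
  nra.
Qed.

Lemma radius_below_r0 (alpha c s : R) : 0 < alpha + c -> 0 <= s < r0 alpha c ->
  exists rho, s < rho < 1 /\ 2 * rho * s < (alpha + c) * (rho ^ 2 - s ^ 2).
Proof.
intros H Hs. destruct (r0_root alpha c H) as [Hr E]. set (a := alpha + c) in *. set (r := r0 alpha c) in *.
(* Since [rho < 1], it suffices that [rho^2 > m], and [s < r0] says exactly that [m < 1]. The
   witness [(1 + m) / 2] works because its square exceeds [m] by [((1 - m) / 2)^2]. *)
set (m := s ^ 2 + 2 * s / a).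
assert (Em : a * m = a * s ^ 2 + 2 * s) by (unfold m; field; lra).
assert (Hm : m < 1).
{ apply Rmult_lt_reg_l with a; auto. rewrite Em.
  assert (s ^ 2 < r ^ 2) by nra. nra. }
assert (Hm0 : s ^ 2 <= m).
{ unfold m. assert (0 <= 2 * s / a); [|lra]. apply Rmult_le_pos. lra.
  apply Rlt_le, Rinv_0_lt_compat; auto. }
exists ((1 + m) / 2).
assert (M2 : m < ((1 + m) / 2) ^ 2) by nra.
assert (Hm1 : 0 <= m) by nra.
split. split; [nra|lra].
assert (a * m < a * ((1 + m) / 2) ^ 2) by (apply Rmult_lt_compat_l; auto). nra.
Qed.

(** * The exponential and the integral relation *)

Lemma Cexp_plus (a b : C) : Cexp (a + b) = (Cexp a * Cexp b)%C.
Proof.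
unfold Cexp. apply C_ext; unfold Re, Im; simpl; rewrite exp_plus, ?cos_plus, ?sin_plus; ring.
Qed.

Lemma Cexp_0 : Cexp (RtoC 0) = RtoC 1.
Proof.
unfold Cexp, Re, Im, RtoC; simpl. rewrite exp_0, cos_0, sin_0. f_equal; ring.
Qed.

Lemma is_derive_0_eps (g : R -> R) (l : R) : is_derive g 0 l ->
  forall eps, 0 < eps -> exists d, 0 < d /\ forall y, Rabs y < d -> Rabs (g y - g 0 - l * y) <= eps * Rabs y.
Proof.
intros H eps He. rewrite is_derive_eps in H. destruct (H eps He) as [d [Hd K]].
exists d; split; auto. intros y Hy. specialize (K y). rewrite Rminus_0_r in K. auto.
Qed.

(** Only the derivatives of [exp], [cos] and [sin] at 0 enter; the functional equation then carries
    the result to every point. *)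
Lemma is_cderive_Cexp_0 : is_cderive Cexp (RtoC 0) (RtoC 1).
Proof.
apply is_cderive_eps. intros eps He.
(* The five error terms sum to at most [7 e N], with [N = |w|]. The bound 1 gives [|1 + x| <= 2],
   and [N < e] takes care of the product [x y]. *)
set (e := Rmin 1 (eps / 16)).
assert (He0 : 0 < e) by (apply Rmin_glb_lt; lra).
assert (He1 : e <= 1) by apply Rmin_l. assert (He2 : e <= eps / 16) by apply Rmin_r.
destruct (is_derive_0_eps exp 1) with e as [d1 [Hd1 K1]]; auto.
{ evar_last. apply is_derive_exp. apply exp_0. }
destruct (is_derive_0_eps cos 0) with e as [d2 [Hd2 K2]]; auto.
{ evar_last. apply is_derive_cos. rewrite sin_0; simpl; ring. }
destruct (is_derive_0_eps sin 1) with e as [d3 [Hd3 K3]]; auto.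
{ evar_last. apply is_derive_sin. apply cos_0. }
exists (Rmin (Rmin d1 d2) (Rmin d3 e)). split.
{ apply Rmin_glb_lt; apply Rmin_glb_lt; auto. }
intros w. rewrite Cexp_0. replace (w - 0)%C with w by ring. intros Hw.
assert (M1 := Rmin_l (Rmin d1 d2) (Rmin d3 e)). assert (M2 := Rmin_r (Rmin d1 d2) (Rmin d3 e)).
assert (M3 := Rmin_l d1 d2). assert (M4 := Rmin_r d1 d2).
assert (M5 := Rmin_l d3 e). assert (M6 := Rmin_r d3 e).
set (N := Cmod w) in *.
set (x := Re w). set (y := Im w).
assert (Hx : Rabs x <= N) by apply re_le_Cmod.
assert (Hy : Rabs y <= N) by apply im_le_Cmod.
specialize (K1 x ltac:(lra)). specialize (K2 y ltac:(lra)). specialize (K3 y ltac:(lra)).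
rewrite exp_0 in K1. rewrite cos_0 in K2. rewrite sin_0 in K3.
eapply Rle_trans. apply Cmod_le_Re_Im.
replace (Re (Cexp w - 1 - 1 * w)%C) with ((exp x - 1 - 1 * x) * cos y + (1 + x) * (cos y - 1 - 0 * y))
  by (unfold x, y, Cexp, Re, Im; simpl; ring).
replace (Im (Cexp w - 1 - 1 * w)%C) with ((exp x - 1 - 1 * x) * sin y + (1 + x) * (sin y - 0 - 1 * y) + x * y)
  by (unfold x, y, Cexp, Re, Im; simpl; ring).
assert (B1 : Rabs (cos y) <= 1) by (apply Rabs_le; apply COS_bound).
assert (B2 : Rabs (sin y) <= 1) by (apply Rabs_le; apply SIN_bound).
assert (B3 : Rabs (1 + x) <= 2).
{ eapply Rle_trans. apply Rabs_triang. rewrite Rabs_R1. lra. }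
assert (N0 : 0 <= N) by apply Cmod_ge_0.
assert (PM : forall a b A B, Rabs a <= A -> Rabs b <= B -> Rabs (a * b) <= A * B).
{ intros a b A0 B0 Ha Hb. rewrite Rabs_mult. apply Rmult_le_compat; auto; apply Rabs_pos. }
assert (T1 := PM _ _ _ _ K1 B1). assert (T2 := PM _ _ _ _ B3 K2).
assert (T3 := PM _ _ _ _ K1 B2). assert (T4 := PM _ _ _ _ B3 K3). assert (T5 := PM _ _ _ _ Hx Hy).
assert (e * Rabs x <= e * N) by (apply Rmult_le_compat_l; lra).
assert (e * Rabs y <= e * N) by (apply Rmult_le_compat_l; lra).
assert (N * N <= e * N) by (apply Rmult_le_compat_r; lra).
assert (16 * (e * N) <= eps * N) by nra.
assert (U1 := Rabs_triang ((exp x - 1 - 1 * x) * cos y) ((1 + x) * (cos y - 1 - 0 * y))).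
assert (U2 := Rabs_triang ((exp x - 1 - 1 * x) * sin y + (1 + x) * (sin y - 0 - 1 * y)) (x * y)).
assert (U3 := Rabs_triang ((exp x - 1 - 1 * x) * sin y) ((1 + x) * (sin y - 0 - 1 * y))).
assert (0 <= e * N) by (apply Rmult_le_pos; lra). lra.
Qed.

Lemma is_cderive_Cexp (z : C) : is_cderive Cexp z (Cexp z).
Proof.
apply is_cderive_ext_loc with (fun w => Cexp z * Cexp (w - z))%C 1. lra.
{ intros w _. rewrite <- Cexp_plus. f_equal. ring. }
eapply is_cderive_eq. apply is_cderive_scal. apply (is_cderive_comp Cexp (fun w => w - z)%C z).
replace (z - z)%C with (RtoC 0) by ring. apply is_cderive_Cexp_0.
apply is_cderive_minus. apply is_cderive_id. apply is_cderive_const. ring.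
Qed.

Lemma is_curve_derive_zero_const (g : R -> C) (a b : R) : a <= b ->
  (forall t, a <= t <= b -> is_curve_derive g t (RtoC 0)) -> g b = g a.
Proof.
intros Hab H.
assert (K : forall f : R -> R, (forall t, a <= t <= b -> is_derive f t 0) -> f b = f a).
{ intros f Hf. destruct (MVT_gen f a b (fun _ => 0)) as [c [_ Hc]].
  - intros x. rewrite Rmin_left, Rmax_right by auto. intros; apply Hf; lra.
  - intros x. rewrite Rmin_left, Rmax_right by auto. intros.
    apply continuity_pt_filterlim. apply @ex_derive_continuous. exists 0. apply Hf; lra.
  - lra. }
apply C_ext.
- apply (K (fun t => Re (g t))). intros t Ht. apply (H t Ht).
- apply (K (fun t => Im (g t))). intros t Ht. apply (H t Ht).
Qed.

Lemma Cmod_scal_lt (t r : R) (z : C) : 0 <= t <= 1 -> Cmod z < r -> Cmod (t * z) < r.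
Proof.
intros Ht Hz. rewrite Cmod_mult, Cmod_R, Rabs_pos_eq by lra. generalize (Cmod_ge_0 z). nra.
Qed.

Lemma is_cderive_zero_const (Q : R) (f : C -> C) (z : C) :
  (forall w, Cmod w < Q -> is_cderive f w (RtoC 0)) -> Cmod z < Q -> f z = f (RtoC 0).
Proof.
intros H Hz.
replace z with (RtoC 1 * z)%C at 1 by ring. replace (RtoC 0) with (RtoC 0 * z)%C by ring.
apply (is_curve_derive_zero_const (fun t => f (t * z)%C) 0 1). lra.
intros t Ht. eapply is_curve_derive_eq. apply is_curve_derive_comp with (f := f). apply H. apply Cmod_scal_lt; auto.
apply is_curve_derive_mult. apply is_curve_derive_RtoC. apply is_curve_derive_const. ring.
Qed.

(* Two logarithms differ by a function with [exp = 1], hence with zero derivative. *)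
Lemma power_branch_unique (Q alpha : R) (f h1 h2 : C -> C) (z : C) : 0 < Q ->
  power_branch Q alpha f h1 -> power_branch Q alpha f h2 -> Cmod z < Q -> h1 z = h2 z.
Proof.
intros HQ [L1 [A1 [Z1 E1]]] [L2 [A2 [Z2 E2]]] Hz.
assert (E : forall w, Cmod w < Q -> Cexp (L1 w - L2 w) = RtoC 1).
{ intros w Hw. destruct (Ceq_dec w (RtoC 0)) as [W|W].
  - rewrite W, Z1, Z2. replace (0 - 0)%C with (RtoC 0) by ring. apply Cexp_0.
  - assert (X : (w * Cexp (L1 w))%C = (w * Cexp (L2 w))%C).
    { rewrite <- (proj1 (E1 w Hw)). apply (proj1 (E2 w Hw)). }
    assert (X' : Cexp (L1 w) = Cexp (L2 w)).
    { replace (Cexp (L1 w)) with (/ w * (w * Cexp (L1 w)))%C by (field; auto).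
      rewrite X. field; auto. }
    unfold Cminus. rewrite Cexp_plus, X', <- Cexp_plus.
    replace (L2 w + - L2 w)%C with (RtoC 0) by ring. apply Cexp_0. }
assert (D : forall w, Cmod w < Q -> is_cderive (fun w => L1 w - L2 w)%C w (RtoC 0)).
{ intros w Hw. destruct (A1 w Hw) as [l1 D1]. destruct (A2 w Hw) as [l2 D2].
  assert (DD := is_cderive_minus _ _ _ _ _ D1 D2).
  assert (DE := is_cderive_comp Cexp _ w _ _ (is_cderive_Cexp _) DD). cbv beta in DE. rewrite E in DE by auto.
  assert (DC : is_cderive (fun w => Cexp (L1 w - L2 w)) w (RtoC 0)).
  { apply is_cderive_disk_ext with (fun _ => RtoC 1) Q; auto. intros; rewrite E; auto. apply is_cderive_const. }
  assert (U := is_cderive_unique _ _ _ _ DE DC). rewrite Cmult_1_r in U. rewrite U in DD. exact DD. }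
assert (K := is_cderive_zero_const Q _ z D Hz). cbv beta in K. rewrite Z1, Z2 in K.
assert (K' : L1 z = L2 z).
{ replace (L1 z) with (L1 z - L2 z + L2 z)%C by ring. rewrite K. ring. }
rewrite (proj2 (E1 z Hz)), (proj2 (E2 z Hz)), K'. reflexivity.
Qed.

Lemma power_branch_analytic (Q alpha : R) (f h : C -> C) : power_branch Q alpha f h -> analytic_in Q h.
Proof.
intros [L [A [Z E]]] z Hz. destruct (A z Hz) as [l D].
eexists. apply is_cderive_disk_ext with (fun w => Cexp (alpha * L w)%C) Q; auto.
intros w Hw. symmetry. apply E; auto.
apply (is_cderive_comp Cexp (fun w => alpha * L w)%C). apply is_cderive_Cexp. apply is_cderive_scal. exact D.
Qed.

(** * The improper integral and the relation a h = a H + z H' *)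

Lemma scal_C_R (x : R) (w : C) : @scal R_AbsRing C_R_NormedModule x w = (x * w)%C.
Proof.
apply C_ext.
- change (x * fst w = x * fst w - 0 * snd w). ring.
- change (x * snd w = x * snd w + 0 * fst w). ring.
Qed.

(** The substitution [u = t s], at the level of filters: right neighbourhoods of 0 are dilated by
    [t]. *)
Lemma is_RInt_gen_rescale (f : R -> C) (I : C) (t : R) : 0 < t ->
  @is_RInt_gen C_R_NormedModule f (at_right 0) (at_point 1) I ->
  @is_RInt_gen C_R_NormedModule (fun u => RtoC (/ t) * f (/ t * u)%R)%C (at_right 0) (at_point t) I.
Proof.
intros Ht H P HP. destruct (H P HP) as [X Y [d HX] HY HXY].
assert (Hd : 0 < d * t) by (apply Rmult_lt_0_compat; [apply cond_pos|auto]).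
apply (Filter_prod _ _ _ (fun x => X (/ t * x)) (fun y => y = t)).
- exists (mkposreal _ Hd). intros x Hx Hx0. apply HX.
  + change (Rabs (x - 0) < d * t) in Hx. change (Rabs (/ t * x - 0) < d).
    rewrite Rminus_0_r in *. rewrite Rabs_mult, (Rabs_pos_eq (/ t)) by (apply Rlt_le, Rinv_0_lt_compat; auto).
    apply Rmult_lt_reg_l with t; auto. rewrite <- Rmult_assoc, Rinv_r by lra. lra.
  + apply Rmult_lt_0_compat; auto. apply Rinv_0_lt_compat; auto.
- reflexivity.
- intros x y Hx Hy. subst y. destruct (HXY _ _ Hx HY) as [J [HJ PJ]].
  exists J. split; auto. simpl in HJ |- *.
  apply (is_RInt_ext (fun y => scal (/ t) (f (/ t * y + 0)))).
  intros u _. rewrite scal_C_R, Rplus_0_r. reflexivity.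
  apply (@is_RInt_comp_lin C_R_NormedModule f (/ t) 0 x t).
  replace (/ t * x + 0) with (/ t * x) by ring. replace (/ t * t + 0) with 1 by (field; lra). exact HJ.
Qed.

Lemma is_RInt_gen_ext_pos (f g : R -> C) (b : R) (I : C) : 0 < b ->
  (forall u, 0 < u -> f u = g u) ->
  @is_RInt_gen C_R_NormedModule f (at_right 0) (at_point b) I ->
  @is_RInt_gen C_R_NormedModule g (at_right 0) (at_point b) I.
Proof.
intros Hb E H. apply is_RInt_gen_ext with (2 := H).
apply (Filter_prod _ _ _ (fun x => 0 < x) (fun y => y = b)).
- exists (mkposreal 1 Rlt_0_1). intros; auto.
- reflexivity.
- intros x y Hx Hy u Hu. subst y. simpl in Hu. apply E.
  apply Rlt_trans with (2 := proj1 Hu). apply Rmin_glb_lt; auto.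
Qed.

(** By homogeneity of [s^(a - 1)], the relation at [t z] becomes, after rescaling, [t^a] times
    [H (t z)] equals [a] times the integral of the same integrand from 0 to [t]. Splitting at 1
    leaves the ordinary integral [J], which can be differentiated in [t]. *)
Lemma integral_relation_scaled (a : R) (H h : C -> C) (z : C) (t : R) :
  0 < a -> analytic_in 1 h -> 0 < t -> Cmod z < 1 -> Cmod (t * z) < 1 ->
  (forall z, Cmod z < 1 -> exists I : C,
        @is_RInt_gen C_R_NormedModule
          (fun s : R => (RtoC (Rpower s (a - 1)) * h (RtoC s * z))%C)
          (at_right 0) (at_point 1) I /\ H z = (RtoC a * I)%C) ->
  forall J, @is_RInt C_R_NormedModule (fun s : R => (RtoC (Rpower s (a - 1)) * h (RtoC s * z))%C) 1 t J ->
  (RtoC (Rpower t a) * H (t * z))%C = (H z + RtoC a * J)%C.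
Proof.
intros Ha An Ht Hz Htz HI J HJ.
destruct (HI z Hz) as [I1 [G1 E1]]. destruct (HI _ Htz) as [I2 [G2 E2]].
set (g := fun s : R => (RtoC (Rpower s (a - 1)) * h (RtoC s * z))%C) in *.
assert (G3 : @is_RInt_gen C_R_NormedModule g (at_right 0) (at_point t) (RtoC (Rpower t a) * I2)%C).
{ apply (is_RInt_gen_rescale _ _ t Ht) in G2.
  apply (@is_RInt_gen_scal C_R_NormedModule _ _ _ _ _ (Rpower t a)) in G2. rewrite scal_C_R in G2.
  apply is_RInt_gen_ext_pos with (3 := G2); auto. intros u Hu. rewrite scal_C_R. unfold g.
  replace (RtoC (/ t * u) * (t * z))%C with (u * z)%C.
  2: { rewrite RtoC_mult. rewrite RtoC_inv by lra. field. intros X; apply RtoC_inj in X; lra. }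
  replace (Rpower t a) with (t * Rpower t (a - 1)).
  2: { rewrite <- (Rpower_1 t) at 1 by auto. rewrite <- Rpower_plus. f_equal; ring. }
  replace (Rpower u (a - 1)) with (Rpower t (a - 1) * Rpower (/ t * u) (a - 1)).
  2: { rewrite Rpower_mult_distr; auto. f_equal. field; lra. apply Rmult_lt_0_compat; auto.
    apply Rinv_0_lt_compat; auto. }
  rewrite !RtoC_mult, RtoC_inv by lra. field. intros X; apply RtoC_inj in X; lra. }
apply (@is_RInt_gen_at_point C_R_NormedModule) in HJ.
assert (G4 := is_RInt_gen_Chasles _ _ _ _ G1 HJ).
assert (U1 := is_RInt_gen_unique (V := C_R_CompleteNormedModule) _ _ G3).
assert (U2 := is_RInt_gen_unique (V := C_R_CompleteNormedModule) _ _ G4).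
rewrite U1 in U2. unfold plus in U2; simpl in U2.
rewrite E1, E2.
replace (RtoC (Rpower t a) * (RtoC a * I2))%C with (RtoC a * (RtoC (Rpower t a) * I2))%C by ring.
rewrite U2. change (a * (I1 + J) = a * I1 + a * J)%C. ring.
Qed.

Lemma is_curve_derive_Rpower (a s : R) : 0 < s -> is_curve_derive (fun t => RtoC (Rpower t a)) s (RtoC (a * Rpower s (a - 1))).
Proof.
intros Hs. split; unfold Re, Im; simpl.
apply is_derive_Reals, derivable_pt_lim_power; auto. apply @is_derive_const.
Qed.

Lemma Ccontinuous_integrand (Q a : R) (h : C -> C) (z : C) (s : R) :
  analytic_in Q h -> 0 < s -> Cmod (s * z) < Q ->
  Ccontinuous (fun s : R => (RtoC (Rpower s (a - 1)) * h (RtoC s * z))%C) s.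
Proof.
intros An Hs Hz. destruct (An _ Hz) as [l D].
eapply is_curve_derive_continuous. apply is_curve_derive_mult. apply is_curve_derive_Rpower; auto.
apply is_curve_derive_comp with (f := h). exact D. apply is_curve_derive_mult. apply is_curve_derive_RtoC. apply is_curve_derive_const.
Qed.

(** Both sides of [integral_relation_scaled] are differentiated at [t = 1]: the left gives
    [a H + z H'], the right [a] times the integrand at 1, that is [a h]. *)
Lemma integral_relation_derivative (a : R) (H h : C -> C) (z l : C) :
  0 < a -> analytic_in 1 h -> Cmod z < 1 -> is_cderive H z l ->
  (forall z, Cmod z < 1 -> exists I : C,
        @is_RInt_gen C_R_NormedModule
          (fun s : R => (RtoC (Rpower s (a - 1)) * h (RtoC s * z))%C)
          (at_right 0) (at_point 1) I /\ H z = (RtoC a * I)%C) ->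
  (a * h z = a * H z + z * l)%C.
Proof.
intros Ha An Hz D HI. assert (C0 := Cmod_ge_0 z).
set (g := fun s : R => (RtoC (Rpower s (a - 1)) * h (RtoC s * z))%C).
(* Room on both sides of 1: [t] stays positive and [t z] in the unit disk. *)
set (d := (1 - Cmod z) / 2).
assert (Hd : 0 < d <= 1 / 2) by (unfold d; lra).
assert (IN : forall t, Rabs (t - 1) < d -> 0 < t /\ Cmod (t * z) < 1).
{ intros t Ht. apply Rabs_def2 in Ht. split. lra.
  rewrite Cmod_mult, Cmod_R, Rabs_pos_eq by lra. unfold d in *. nra. }
assert (HJ : forall t, Rabs (t - 1) < d -> is_RInt g 1 t (@RInt C_R_CompleteNormedModule g 1 t)).
{ intros t Ht. apply (@RInt_correct C_R_CompleteNormedModule).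
  apply (@ex_RInt_continuous C_R_CompleteNormedModule). intros s Hs.
  assert (S : Rabs (s - 1) < d).
  { apply Rabs_def2 in Ht. apply Rabs_def1; destruct Hs as [Hs1 Hs2];
    unfold Rmin, Rmax in *; destruct (Rle_dec 1 t); lra. }
  destruct (IN s S). apply (Ccontinuous_integrand 1); auto. }
set (J := fun t => @RInt C_R_CompleteNormedModule g 1 t) in *.
assert (DJ : @is_derive R_AbsRing C_R_NormedModule J 1 (g 1)).
{ apply (@is_derive_RInt C_R_NormedModule g J 1 1).
  exists (mkposreal d (proj1 Hd)). intros t Ht. apply HJ. exact Ht.
  destruct (IN 1) as [I1 I2]. rewrite Rminus_diag, Rabs_R0; lra.
  apply (Ccontinuous_integrand 1); auto. }
assert (PJ : is_curve_derive J 1 (g 1)).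
{ split.
  - apply (filterdiff_comp' J (fst : C -> R) 1 _ fst DJ).
    apply filterdiff_linear. apply is_linear_fst.
  - apply (filterdiff_comp' J (snd : C -> R) 1 _ snd DJ).
    apply filterdiff_linear. apply is_linear_snd. }
assert (P1 : is_curve_derive (fun t => H z + a * J t)%C 1 (a * g 1)%C).
{ eapply is_curve_derive_eq. apply is_curve_derive_plus. apply is_curve_derive_const. apply is_curve_derive_scal. apply PJ. ring. }
assert (P2 : is_curve_derive (fun t => RtoC (Rpower t a) * H (t * z))%C 1 (a * H z + z * l)%C).
{ eapply is_curve_derive_eq. apply is_curve_derive_mult. apply is_curve_derive_Rpower; lra. apply is_curve_derive_comp with (f := H).
  replace (RtoC 1 * z)%C with z by ring. exact D. apply is_curve_derive_mult. apply is_curve_derive_RtoC. apply is_curve_derive_const.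
  unfold Rpower. rewrite ln_1, !Rmult_0_r, exp_0, Rmult_1_r.
  replace (RtoC 1 * z)%C with z by ring. ring. }
assert (P3 : is_curve_derive (fun t => RtoC (Rpower t a) * H (t * z))%C 1 (a * g 1)%C).
{ destruct P1 as [Q1 Q2].
  assert (E : forall t, Rabs (t - 1) < d -> (H z + a * J t)%C = (RtoC (Rpower t a) * H (t * z))%C).
  { intros t Ht. destruct (IN t Ht). symmetry. apply (integral_relation_scaled a H h); auto. }
  split; (eapply is_derive_ext_loc; [|eassumption]); exists (mkposreal d (proj1 Hd)); intros t Ht; cbv beta; rewrite E; auto. }
assert (U : (a * g 1 = a * H z + z * l)%C).
{ apply C_ext.
  - rewrite <- (is_derive_unique _ _ _ (proj1 P3)). apply is_derive_unique, P2.
  - rewrite <- (is_derive_unique _ _ _ (proj2 P3)). apply is_derive_unique, P2. }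
rewrite <- U. unfold g. unfold Rpower. rewrite ln_1, Rmult_0_r, exp_0.
replace (RtoC 1 * z)%C with z by ring. ring.
Qed.

(** The real mean value theorem is applied to each component, at possibly different points; hence
    the factor 2. *)
Lemma is_curve_derive_mean_value (g d : R -> C) (M : R) :
  (forall s, 0 <= s <= 1 -> is_curve_derive g s (d s)) -> (forall s, 0 < s < 1 -> Cmod (d s) <= M) ->
  Cmod (g 1%R - g 0%R) <= 2 * M.
Proof.
intros H HM. eapply Rle_trans. apply Cmod_le_Re_Im.
destruct (MVT_cor2 (fun s => Re (g s)) (fun s => Re (d s)) 0 1 ltac:(lra)) as [x [Ex Hx]].
{ intros s Hs. apply is_derive_Reals. apply (H s Hs). }
destruct (MVT_cor2 (fun s => Im (g s)) (fun s => Im (d s)) 0 1 ltac:(lra)) as [y [Ey Hy]].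
{ intros s Hs. apply is_derive_Reals. apply (H s Hs). }
change (Re (g 1%R - g 0%R)%C) with (Re (g 1) - Re (g 0)). rewrite Ex.
change (Im (g 1%R - g 0%R)%C) with (Im (g 1) - Im (g 0)). rewrite Ey.
assert (X := Rle_trans _ _ _ (re_le_Cmod (d x)) (HM x Hx)).
assert (Y := Rle_trans _ _ _ (im_le_Cmod (d y)) (HM y Hy)).
rewrite !Rminus_0_r, !Rmult_1_r. lra.
Qed.

(** The mean value inequality on the segment from 0 to [w], for [f] minus its candidate linear part.
    It identifies [H' 0], which cannot be read from [z H'] by division. *)
Lemma is_cderive_0_of_derive_limit (f f' : C -> C) (l : C) :
  (forall z, Cmod z < 1 -> is_cderive f z (f' z)) ->
  (forall eps, 0 < eps -> exists d, 0 < d /\ forall w, w <> RtoC 0 -> Cmod w < d -> Cmod (f' w - l) <= eps) ->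
  is_cderive f (RtoC 0) l.
Proof.
intros Hf Hl. apply is_cderive_eps. intros eps He.
destruct (Hl (eps / 2)) as [d [Hd K]]. lra.
exists (Rmin d 1). split. apply Rmin_glb_lt; lra.
intros w. replace (w - 0)%C with w by ring. intros Hw.
assert (W1 := Rlt_le_trans _ _ _ Hw (Rmin_l _ _)).
assert (W2 := Rlt_le_trans _ _ _ Hw (Rmin_r _ _)).
destruct (Ceq_dec w (RtoC 0)) as [W|W].
{ rewrite W. replace (f 0 - f 0 - l * 0)%C with (RtoC 0) by ring. rewrite Cmod_0. lra. }
assert (M := is_curve_derive_mean_value (fun s => f (s * w) - l * (s * w))%C (fun s => (f' (s * w) - l) * w)%C (eps / 2 * Cmod w)).
cbv beta in M.
replace (f (1 * w) - l * (1 * w) - (f (0 * w) - l * (0 * w)))%C with (f w - f 0 - l * w)%C in M.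
2: { replace (RtoC 1 * w)%C with w by ring. replace (RtoC 0 * w)%C with (RtoC 0) by ring. ring. }
eapply Rle_trans. apply M.
- intros s Hs. eapply is_curve_derive_eq. apply is_curve_derive_plus.
  apply is_curve_derive_comp with (f := f). apply Hf. apply Cmod_scal_lt; auto.
  apply is_curve_derive_mult. apply is_curve_derive_RtoC. apply is_curve_derive_const.
  apply is_curve_derive_comp with (f := Copp) (g := fun s => (l * (s * w))%C).
  apply is_cderive_ext_loc with (fun w => (- (1)) * w)%C 1. lra. intros; ring. apply is_cderive_scal. apply is_cderive_id.
  apply is_curve_derive_scal. apply is_curve_derive_mult. apply is_curve_derive_RtoC. apply is_curve_derive_const. cbv beta. ring.
- intros s Hs. rewrite Cmod_mult. apply Rmult_le_compat_r. apply Cmod_ge_0.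
  apply K. apply Cmult_neq_0; auto. intros X; apply RtoC_inj in X; lra.
  apply Cmod_scal_lt; auto. lra.
- lra.
Qed.

Lemma C_derive_is_cderive (f : C -> C) (Q : R) (z : C) : analytic_in Q f -> Cmod z < Q -> is_cderive f z (C_derive f z).
Proof. intros H Hz. apply C_derive_correct; auto. Qed.

(* The right-hand side of [z H' = a (h - H)] is continuous, which gives the continuity of [H']
   without Goursat's theorem. *)
Lemma euler_relation_holo (a : R) (H h : C -> C) :
  analytic_in 1 H -> analytic_in 1 h ->
  (forall z, Cmod z < 1 -> (a * h z = a * H z + z * C_derive H z)%C) ->
  holo 1 H (C_derive H).
Proof.
intros AH Ah E z Hz. assert (C0 := Cmod_ge_0 z).
split. apply (C_derive_is_cderive H 1); auto.
set (k := fun w => (a * (h w - H w))%C).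
assert (Ek : forall w, Cmod w < 1 -> k w = (w * C_derive H w)%C).
{ intros w Hw. unfold k. replace (a * (h w - H w))%C with (a * h w - a * H w)%C by ring.
  rewrite E by auto. ring. }
assert (Dk : forall w, Cmod w < 1 -> is_cderive k w (a * (C_derive h w - C_derive H w))%C).
{ intros w Hw. unfold k. apply is_cderive_scal. apply is_cderive_minus; apply (C_derive_is_cderive _ 1); auto. }
(* Off the origin [H'] is the continuous quotient [k w / w]; at the origin this quotient tends to
   [k' 0], which is therefore [H' 0]. *)
destruct (Ceq_dec z (RtoC 0)) as [Z|Z].
- rewrite Z.
  assert (L := Dk (RtoC 0) ltac:(rewrite Cmod_0; lra)).
  set (l := (a * (C_derive h 0 - C_derive H 0))%C) in *.
  rewrite is_cderive_eps in L.
  assert (B : forall eps, 0 < eps -> exists d, 0 < d /\ forall w, w <> RtoC 0 -> Cmod w < d -> Cmod (C_derive H w - l) <= eps).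
  { intros eps He. destruct (L eps He) as [d [Hd K]]. exists (Rmin d 1).
    split. apply Rmin_glb_lt; lra. intros w W Hw.
    assert (W1 := Rlt_le_trans _ _ _ Hw (Rmin_l _ _)).
    assert (W2 := Rlt_le_trans _ _ _ Hw (Rmin_r _ _)).
    specialize (K w). replace (w - 0)%C with w in K by ring. specialize (K W1).
    rewrite !Ek in K by (try rewrite Cmod_0; lra).
    replace (w * C_derive H w - 0 * C_derive H 0 - l * w)%C with (w * (C_derive H w - l))%C in K by ring.
    rewrite Cmod_mult in K. apply Rmult_le_reg_l with (Cmod w). apply Cmod_gt_0; auto. lra. }
  assert (El : C_derive H (RtoC 0) = l).
  { apply is_C_derive_unique. apply is_cderive_0_of_derive_limit with (C_derive H); auto.
    intros w Hw. apply (C_derive_is_cderive H 1); auto. }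
  apply Ccontinuous_eps. intros eps He. destruct (B (eps / 2)) as [d [Hd K]]. lra.
  exists d. split; auto. intros w. replace (w - 0)%C with w by ring. intros Hw.
  rewrite El. destruct (Ceq_dec w (RtoC 0)) as [W|W].
  + rewrite W, El. replace (l - l)%C with (RtoC 0) by ring. rewrite Cmod_0. lra.
  + specialize (K w W Hw). lra.
- assert (Cz := proj1 (Cmod_gt_0 z) Z).
  assert (CC : Ccontinuous (fun w : C_UniformSpace => / w * k w)%C z).
  { apply Ccontinuous_mult. apply (Ccontinuous_inv (T := C_UniformSpace) (fun w => w)); auto. apply continuous_id.
    eapply is_cderive_continuous. apply Dk; auto. }
  apply continuous_ext_loc with (2 := CC).
  apply locally_Cmod. exists (Rmin (Cmod z) (1 - Cmod z)). split. apply Rmin_glb_lt; lra.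
  intros w Hw.
  assert (W1 := Rlt_le_trans _ _ _ Hw (Rmin_l _ _)).
  assert (W2 := Rlt_le_trans _ _ _ Hw (Rmin_r _ _)).
  assert (Cmod w < 1).
  { replace w with ((w - z) + z)%C by ring. eapply Rle_lt_trans. apply Cmod_triangle. lra. }
  rewrite Ek by auto. ceq. field. intros X. rewrite X in W1.
  replace (0 - z)%C with (- z)%C in W1 by ring. rewrite Cmod_opp in W1. lra.
Qed.

(** * The inclusion inside the radius r0 *)

Lemma Re_div_R (z : C) (r : R) : r <> 0 -> Re (z / RtoC r)%C = Re z / r.
Proof.
intros H. unfold Cdiv. rewrite <- RtoC_inv by auto. rewrite Re_mult.
unfold Re, Im, RtoC; simpl. unfold Rdiv; ring.
Qed.

Lemma theorem3p9_inclusion (n : nat) (alpha beta c : R) (F f h : C -> C) (z : C) :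
  0 < alpha -> 0 < alpha + c ->
  class_T n alpha beta F -> integral_relation alpha c F f h ->
  Cmod z < r0 alpha c -> beta < Re (salagean_quot n alpha h z).
Proof.
intros Hal Hc [_ [H1 [B1 T1]]] [H [B [Ah [_ HI]]]] Hz. assert (C0 := Cmod_ge_0 z).
set (a := alpha + c) in *.
assert (An : 0 < alpha ^ n) by (apply pow_lt; auto).
assert (AH := power_branch_analytic 1 alpha F H B).
assert (Er : forall w, Cmod w < 1 -> (a * h w = a * H w + w * C_derive H w)%C).
{ intros w Hw. apply (integral_relation_derivative a H h w); auto. apply (C_derive_is_cderive H 1); auto. }
assert (HH := euler_relation_holo a H h AH Ah Er).
destruct (radius_below_r0 alpha c (Cmod z) Hc) as [rho [Hr Hs]]. lra.
(* Strictly between [rho] and 1: the circle of radius [rho] lies in the disk of the series, and that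
   disk well inside the unit disk. *)
set (Q := (1 + rho) / 2).
destruct (holo_power_series 1 Q H (C_derive H) HH) as [u [Hu Eu]]. unfold Q; lra.
(* [H1] is the branch supplied by the class and [H] the one supplied by the integral relation. *)
assert (E1 : forall w, Cmod w < Q -> H1 w = Cpseries u w).
{ intros w Hw. rewrite <- Eu by auto. apply (power_branch_unique 1 alpha F); auto. lra. unfold Q in Hw; lra. }
assert (Eh : forall w, Cmod w < Q -> h w = Cpseries (fun k => (1 + / a * INR k) * u k)%C w).
{ intros w Hw. rewrite (Cpseries_lin Q) by auto.
  assert (W1 : Cmod w < 1) by (unfold Q in Hw; lra).
  assert (a0 : RtoC a <> RtoC 0) by (intros X; apply RtoC_inj in X; lra).
  assert (D : C_derive H w = Cpseries (dcoef u) w).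
  { apply is_C_derive_unique. apply is_cderive_disk_ext with (Cpseries u) Q; auto. intros; symmetry; auto.
    apply is_cderive_Cpseries with Q; auto. }
  specialize (Er w W1). rewrite D, Eu in Er by auto.
  replace (h w) with (/ a * (a * h w))%C by (field; auto). rewrite Er. field. auto. }
destruct (salagean_iter_Cpseries Q alpha u H1 n Hu E1) as [V S1].
destruct (salagean_iter_Cpseries Q alpha _ h n (cv_disk_lin_coef Q u 1 (/ a)%C Hu) Eh) as [_ S2].
set (v := fun k => ((alpha + 1 * INR k) ^ n * u k)%C) in *.
(* Coefficient multipliers commute, so applying [D] [n] times to [h] amounts to applying
   [1 + (z d/dz) / a] to the series of [v]: this is [q = p + z p' / a], up to the factor
   [alpha^n]. *)
assert (Ez : Nat.iter n (salagean_factor alpha) h z = (1 * Cpseries v z + / a * (z * Cpseries (dcoef v) z))%C).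
{ assert (ZQ : Cmod z < Q) by (unfold Q; lra).
  rewrite S2 by auto. rewrite <- (Cpseries_lin Q) by auto. apply Cpseries_ext. intros k. unfold v. ring. }
unfold salagean_quot. rewrite Re_div_R by lra.
apply Rmult_lt_reg_r with (alpha ^ n); auto. unfold Rdiv. rewrite Rmult_assoc, Rinv_l, Rmult_1_r by lra.
(* Harnack is applied to [alpha^n (p - beta)], which has positive real part and the same derivative
   as the series of [v]. *)
assert (HP : holo Q (fun w => Cpseries v w - RtoC (beta * alpha ^ n))%C (Cpseries (dcoef v))).
{ intros w Hw. destruct (holo_Cpseries Q v V w Hw) as [D1 D2]. split; auto.
  eapply is_cderive_eq. apply is_cderive_minus. apply D1. apply is_cderive_const. ring. }
assert (Pos : forall w, Cmod w < Q -> 0 < Re (Cpseries v w - RtoC (beta * alpha ^ n))%C).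
{ intros w Hw. assert (T := T1 w ltac:(unfold Q in Hw; lra)). unfold salagean_quot in T.
  rewrite Re_div_R in T by lra. rewrite S1 in T by auto.
  apply Rmult_lt_compat_r with (r := alpha ^ n) in T; auto.
  unfold Rdiv in T. rewrite Rmult_assoc, Rinv_l, Rmult_1_r in T by lra.
  change (0 < Re (Cpseries v w) - beta * alpha ^ n). lra. }
assert (R := re_pos_transfer Q rho a _ _ z Hc HP Pos ltac:(lra) ltac:(unfold Q; lra) Hs).
cbv beta in R. rewrite Ez.
rewrite Cmult_1_l. rewrite <- RtoC_inv by lra.
change (Re (Cpseries v z + RtoC (/ a) * (z * Cpseries (dcoef v) z))%C) with
  (Re (Cpseries v z) + (/ a * Re (z * Cpseries (dcoef v) z)%C - 0 * Im (z * Cpseries (dcoef v) z)%C)).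
change (Re (Cpseries v z - RtoC (beta * alpha ^ n))%C) with (Re (Cpseries v z) - beta * alpha ^ n) in R. lra.
Qed.

(** * The logarithm and powers of functions with positive real part *)

Definition Clog (w : C) : C := (ln (Re w ^ 2 + Im w ^ 2) / 2, atan (Im w / Re w)).

(** On the right half-plane [atan (Im w / Re w)] is the argument, and [x sqrt (1 + (y / x)^2)] is
    the modulus. *)
Lemma Cexp_Clog (w : C) : 0 < Re w -> Cexp (Clog w) = w.
Proof.
intros H. set (x := Re w) in *. set (y := Im w).
change (Cexp (Clog w)) with
  (exp (ln (x ^ 2 + y ^ 2) / 2) * cos (atan (y / x)), exp (ln (x ^ 2 + y ^ 2) / 2) * sin (atan (y / x))).
assert (X : exp (ln (x ^ 2 + y ^ 2) / 2) = x * sqrt (1 + (y / x)²)).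
{ replace (ln (x ^ 2 + y ^ 2) / 2) with (/ 2 * ln (x ^ 2 + y ^ 2)) by field.
  change (Rpower (x ^ 2 + y ^ 2) (/ 2) = x * sqrt (1 + (y / x)²)).
  rewrite Rpower_sqrt by nra.
  rewrite <- (sqrt_pow2 x) at 2 by lra. rewrite <- sqrt_mult by (try apply Rplus_le_le_0_compat; try apply Rle_0_sqr; nra).
  f_equal. unfold Rsqr. field. lra. }
rewrite X, cos_atan, sin_atan.
assert (S : 0 < sqrt (1 + (y / x)²)) by (apply sqrt_lt_R0; generalize (Rle_0_sqr (y / x)); lra).
apply C_ext.
- change (x * sqrt (1 + (y / x)²) * (1 / sqrt (1 + (y / x)²)) = x). field; lra.
- change (x * sqrt (1 + (y / x)²) * (y / x / sqrt (1 + (y / x)²)) = y). field; lra.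
Qed.

Lemma Clog_1 : Clog (RtoC 1) = RtoC 0.
Proof.
unfold Clog, RtoC, Re, Im; simpl. f_equal.
- replace (1 * (1 * 1) + 0 * (0 * 1)) with 1 by ring. rewrite ln_1. field.
- replace (0 / 1) with 0 by field. apply atan_0.
Qed.

Lemma Ccontinuous_Clog (w : C) : 0 < Re w -> Ccontinuous (Clog : C_UniformSpace -> C) w.
Proof.
intros H.
assert (CR : @continuous C_UniformSpace R_UniformSpace Re w) by apply continuous_fst.
assert (circle_int : @continuous C_UniformSpace R_UniformSpace Im w) by apply continuous_snd.
apply Ccontinuous_pair. split.
- apply (continuous_ext (T := C_UniformSpace) (U := R_UniformSpace) (fun w => scal (/ 2) (ln (Re w * Re w + Im w * Im w)))).
  { intros v. unfold Clog, Re at 3; simpl. unfold scal; simpl; unfold mult; simpl.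
    rewrite !Rmult_1_r. field. }
  apply (@continuous_scal_r C_UniformSpace R_AbsRing R_NormedModule).
  apply (continuous_comp (U := C_UniformSpace) (V := R_UniformSpace) (fun w => Re w * Re w + Im w * Im w) ln).
  apply (@continuous_plus C_UniformSpace R_AbsRing R_NormedModule); apply (@continuous_mult C_UniformSpace R_AbsRing); auto.
  apply @ex_derive_continuous. eexists. apply is_derive_ln. nra.
- unfold Clog, Im at 1; simpl.
  apply (continuous_comp (U := C_UniformSpace) (V := R_UniformSpace) (fun w => Im w / Re w) atan).
  apply (@continuous_mult C_UniformSpace R_AbsRing); auto.
  apply (continuous_comp (U := C_UniformSpace) (V := R_UniformSpace) Re Rinv); auto.
  apply @ex_derive_continuous. auto_derive. lra.
  apply @ex_derive_continuous. eexists. apply is_derive_atan.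
Qed.

(** Derivative of an inverse function: the expansion of [Cexp] at [Clog w] is solved for the
    increment of [Clog], whose smallness comes from [Ccontinuous_Clog]. *)
Lemma is_cderive_Clog (w : C) : 0 < Re w -> is_cderive Clog w (/ w)%C.
Proof.
intros H. assert (W0 : w <> RtoC 0) by (intros X; rewrite X in H; unfold Re, RtoC in H; simpl in H; lra).
assert (Hm := proj1 (Cmod_gt_0 w) W0). set (m := Cmod w) in *.
assert (D := is_cderive_Cexp (Clog w)). rewrite Cexp_Clog in D by auto.
rewrite is_cderive_eps in D.
assert (Cn := proj1 (Ccontinuous_eps Clog w) (Ccontinuous_Clog w H)).
apply is_cderive_eps. intros eps He.
set (e := Rmin (m / 2) (eps * (m * m) / 2)).
assert (He0 : 0 < e).
{ apply Rmin_glb_lt. lra. assert (0 < m * m) by nra. assert (0 < eps * (m * m)) by (apply Rmult_lt_0_compat; auto). lra. }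
assert (E1 : e <= m / 2) by apply Rmin_l. assert (E2 : e <= eps * (m * m) / 2) by apply Rmin_r.
destruct (D e He0) as [d1 [Hd1 K1]]. destruct (Cn d1 Hd1) as [d2 [Hd2 K2]].
exists (Rmin d2 (Re w)). split. apply Rmin_glb_lt; auto.
intros v Hv.
assert (V1 := Rlt_le_trans _ _ _ Hv (Rmin_l _ _)).
assert (V2 := Rlt_le_trans _ _ _ Hv (Rmin_r _ _)).
assert (Hre : 0 < Re v).
{ assert (X := re_le_Cmod (v - w)). change (Re (v - w)%C) with (Re v - Re w) in X.
  assert (Y := Rle_abs (- (Re v - Re w))). rewrite Rabs_Ropp in Y. lra. }
specialize (K1 _ (K2 v V1)). rewrite (Cexp_Clog v Hre), (Cexp_Clog w H) in K1.
set (dl := (Clog v - Clog w)%C) in *. set (dw := (v - w)%C) in *.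
(* As [e <= m / 2], the last term is absorbed on the left, so that [|dl|] is at most
   [2 |dw| / m]. *)
assert (B : m * Cmod dl <= Cmod dw + e * Cmod dl).
{ unfold m. rewrite <- Cmod_mult. replace (w * dl)%C with (dw + - (dw - w * dl))%C by ring.
  eapply Rle_trans. apply Cmod_triangle. rewrite Cmod_opp. lra. }
assert (P1 := Cmod_ge_0 dl). assert (P2 := Cmod_ge_0 dw).
assert (B2 : m * Cmod dl <= 2 * Cmod dw) by nra.
replace (dl - / w * dw)%C with (- (/ w * (dw - w * dl)))%C by (field; auto).
rewrite Cmod_opp, Cmod_mult, Cmod_inv by auto. fold m.
apply Rmult_le_reg_l with (m * m). nra.
replace (m * m * (/ m * Cmod (dw - w * dl))) with (m * Cmod (dw - w * dl)) by (field; lra).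
apply Rle_trans with (m * (e * Cmod dl)). apply Rmult_le_compat_l; lra.
replace (m * (e * Cmod dl)) with (e * (m * Cmod dl)) by ring.
apply Rle_trans with (e * (2 * Cmod dw)). apply Rmult_le_compat_l; lra.
assert (e * (2 * Cmod dw) <= eps * (m * m) / 2 * (2 * Cmod dw)) by (apply Rmult_le_compat_r; lra). lra.
Qed.

(** Positive real part gives [h] a logarithm vanishing at 0, hence a function whose power [alpha] is
    [z^alpha h]; the functions [F] and [f] of the extremal example are built this way. *)
Lemma power_branch_of_pos_re (Q alpha : R) (h : C -> C) :
  alpha <> 0 -> analytic_in Q h -> h (RtoC 0) = RtoC 1 -> (forall z, Cmod z < Q -> 0 < Re (h z)) ->
  power_branch Q alpha (fun z => z * Cexp (/ alpha * Clog (h z)))%C h.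
Proof.
intros Ha A H0 Hp. exists (fun z => / alpha * Clog (h z))%C. repeat split.
- intros z Hz. destruct (A z Hz) as [l D]. eexists. apply is_cderive_scal.
  apply (is_cderive_comp Clog h). apply is_cderive_Clog; auto. exact D.
- rewrite H0, Clog_1. ring.
- replace (alpha * (/ alpha * Clog (h z)))%C with (Clog (h z)). symmetry; apply Cexp_Clog; auto.
  field. intros X; apply RtoC_inj in X; lra.
Qed.

Lemma power_branch_class_A (alpha : R) (f h : C -> C) : power_branch 1 alpha f h -> class_A f.
Proof.
intros [L [A [L0 E]]].
assert (D : forall z l, Cmod z < 1 -> is_cderive L z l -> is_cderive f z (1 * Cexp (L z) + z * (l * Cexp (L z)))%C).
{ intros z l Hz Dl. apply is_cderive_disk_ext with (fun w => w * Cexp (L w))%C 1; auto.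
  intros w Hw. symmetry. apply E; auto.
  apply (is_cderive_mult (fun w => w) (fun w => Cexp (L w))). apply is_cderive_id. apply (is_cderive_comp Cexp L). apply is_cderive_Cexp. exact Dl. }
assert (M0 : Cmod (RtoC 0) < 1) by (rewrite Cmod_0; lra).
repeat split.
- intros z Hz. destruct (A z Hz) as [l Dl]. eexists. apply D; eauto.
- rewrite (proj1 (E _ M0)). ring.
- destruct (A _ M0) as [l Dl]. apply is_C_derive_unique. eapply is_cderive_eq. apply D; eauto.
  rewrite L0, Cexp_0. ring.
Qed.

Lemma pos_re_near (Q : R) (h : C -> C) : 0 < Q -> analytic_in Q h -> 0 < Re (h (RtoC 0)) ->
  exists d, 0 < d <= Q /\ forall z, Cmod z < d -> 0 < Re (h z).
Proof.
intros HQ A H0. destruct (A (RtoC 0)) as [l D]. rewrite Cmod_0; auto.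
apply is_cderive_continuous in D. destruct (proj1 (Ccontinuous_eps _ _) D _ H0) as [d [Hd K]].
exists (Rmin d Q). split. split. apply Rmin_glb_lt; auto. apply Rmin_r.
intros z Hz. specialize (K z). replace (z - 0)%C with z in K by ring.
specialize (K (Rlt_le_trans _ _ _ Hz (Rmin_l _ _))).
assert (X := re_le_Cmod (h z - h (RtoC 0))). change (Re (h z - h (RtoC 0))%C) with (Re (h z) - Re (h (RtoC 0))) in X.
assert (Y := Rle_abs (- (Re (h z) - Re (h (RtoC 0))))). rewrite Rabs_Ropp in Y. lra.
Qed.

Lemma is_curve_derive_weighted_ray (a s : R) (H h : C -> C) (z l : C) : 0 < s ->
  is_cderive H (s * z)%C l -> (a * h (s * z) = a * H (s * z) + (s * z) * l)%C ->
  is_curve_derive (fun t => RtoC (Rpower t a) * H (t * z))%C s (a * (RtoC (Rpower s (a - 1)) * h (s * z)))%C.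
Proof.
intros Hs D E. eapply is_curve_derive_eq. apply is_curve_derive_mult. apply is_curve_derive_Rpower; auto.
apply is_curve_derive_comp with (f := H). exact D. apply is_curve_derive_mult. apply is_curve_derive_RtoC. apply is_curve_derive_const.
cbv beta. replace (Rpower s a) with (s * Rpower s (a - 1)).
2: { rewrite <- (Rpower_1 s) at 1 by auto. rewrite <- Rpower_plus. f_equal; ring. }
replace (a * (RtoC (Rpower s (a - 1)) * h (s * z)))%C with (RtoC (Rpower s (a - 1)) * (a * h (s * z)))%C by ring.
rewrite E, !RtoC_mult. ring.
Qed.

(* [s^a Re H(s z)] increases along rays, since its derivative is [a s^(a-1) Re h(s z)]. *)
Lemma euler_relation_pos (a : R) (H h : C -> C) (z : C) : 0 < a ->
  analytic_in 1 H -> 0 < Re (H (RtoC 0)) ->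
  (forall z, Cmod z < 1 -> (a * h z = a * H z + z * C_derive H z)%C) ->
  (forall z, Cmod z < 1 -> 0 < Re (h z)) -> Cmod z < 1 -> 0 < Re (H z).
Proof.
intros Ha A H0 E Hp Hz. assert (C0 := Cmod_ge_0 z).
destruct (pos_re_near 1 H Rlt_0_1 A H0) as [d [Hd K]].
(* The starting point on the ray, close enough to 0 for [Re H] to be positive by continuity; it also
   avoids the possible singularity of [s^(a - 1)] at 0. *)
set (s0 := d / 2).
assert (P : forall s, s0 <= s <= 1 -> is_derive (fun t => Re (RtoC (Rpower t a) * H (t * z))%C) s
  (Re (a * (RtoC (Rpower s (a - 1)) * h (s * z)))%C)).
{ intros s Hs. assert (Hsz : Cmod (s * z) < 1) by (apply Cmod_scal_lt; auto; unfold s0 in Hs; lra).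
  apply (is_curve_derive_weighted_ray a s H h z (C_derive H (s * z))). unfold s0 in Hs; lra.
  apply (C_derive_is_cderive H 1); auto. apply E; auto. }
destruct (MVT_cor2 (fun t => Re (RtoC (Rpower t a) * H (t * z))%C)
  (fun s => Re (a * (RtoC (Rpower s (a - 1)) * h (s * z)))%C) s0 1) as [c [Ec Hc]].
unfold s0; lra. intros; apply is_derive_Reals; apply P; auto.
assert (RR : forall (x : R) (w : C), Re (RtoC x * w)%C = x * Re w) by (intros; unfold Re, Im, RtoC; simpl; ring).
rewrite !RR in Ec.
replace (RtoC 1 * z)%C with z in Ec by ring.
assert (1 * Re (H z) > 0).
{ replace 1 with (Rpower 1 a). 2: unfold Rpower; rewrite ln_1, Rmult_0_r; apply exp_0.
  assert (0 < Rpower s0 a * Re (H (s0 * z)%C)).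
  { apply Rmult_lt_0_compat. apply exp_pos. apply K. rewrite Cmod_mult, Cmod_R, Rabs_pos_eq by (unfold s0; lra).
    unfold s0; nra. }
  assert (0 < a * (Rpower c (a - 1) * Re (h (c * z)%C)) * (1 - s0)).
  { apply Rmult_lt_0_compat. apply Rmult_lt_0_compat; auto. apply Rmult_lt_0_compat. apply exp_pos.
    apply Hp. apply Cmod_scal_lt; auto. unfold s0 in Hc; lra. unfold s0; lra. }
  lra. }
lra.
Qed.

Lemma Rpower_lt_small (a e x : R) : 0 < a -> 0 < e -> 0 < x < Rpower e (/ a) -> Rpower x a < e.
Proof.
intros Ha He Hx. replace e with (Rpower (Rpower e (/ a)) a).
apply Rlt_Rpower_l; auto. rewrite Rpower_mult, Rinv_l, Rpower_1; lra.
Qed.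

(** Converse of [integral_relation_derivative]: [K s = s^a H (s z) / a] is a primitive of the
    integrand, and it tends to 0 with [s] because [a > 0] and [H] is bounded near 0. *)
Lemma euler_relation_integral (a : R) (H h : C -> C) (z : C) : 0 < a ->
  analytic_in 1 H -> analytic_in 1 h ->
  (forall z, Cmod z < 1 -> (a * h z = a * H z + z * C_derive H z)%C) -> Cmod z < 1 ->
  @is_RInt_gen C_R_NormedModule
          (fun s : R => (RtoC (Rpower s (a - 1)) * h (RtoC s * z))%C)
          (at_right 0) (at_point 1) (/ a * H z)%C.
Proof.
intros Ha A Ah E Hz. assert (C0 := Cmod_ge_0 z).
set (g := fun s : R => (RtoC (Rpower s (a - 1)) * h (RtoC s * z))%C).
assert (a0 : RtoC a <> RtoC 0) by (intros X; apply RtoC_inj in X; lra).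
set (K := fun s : R => (/ a * (RtoC (Rpower s a) * H (s * z)))%C).
assert (DK : forall s, 0 < s <= 1 -> is_curve_derive K s (g s)).
{ intros s Hs. assert (Hsz : Cmod (s * z) < 1) by (apply Cmod_scal_lt; auto; lra).
  eapply is_curve_derive_eq. apply is_curve_derive_scal. apply (is_curve_derive_weighted_ray a s H h z (C_derive H (s * z))). lra.
  apply (C_derive_is_cderive H 1); auto. apply E; auto. unfold g. field. auto. }
assert (I : forall x, 0 < x <= 1 -> @is_RInt C_R_NormedModule g x 1 (K 1 - K x)%C).
{ intros x Hx.
  assert (CC : forall s, Rmin x 1 <= s <= Rmax x 1 -> 0 < s <= 1 /\ Ccontinuous g s).
  { intros s. rewrite Rmin_left, Rmax_right by lra. intros Hs. split. lra.
    apply (Ccontinuous_integrand 1); auto. lra. apply Cmod_scal_lt; auto; lra. }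
  apply (is_RInt_fct_extend_pair (U := R_NormedModule) (V := R_NormedModule) g x 1 (Re (K 1 - K x)%C) (Im (K 1 - K x)%C)).
  - apply (is_RInt_derive (V := R_CompleteNormedModule) (fun t => Re (K t)) (fun t => Re (g t))); intros s Hs.
    apply (DK s), CC, Hs. apply (proj1 (Ccontinuous_pair g s) (proj2 (CC s Hs))).
  - apply (is_RInt_derive (V := R_CompleteNormedModule) (fun t => Im (K t)) (fun t => Im (g t))); intros s Hs.
    apply (DK s), CC, Hs. apply (proj1 (Ccontinuous_pair g s) (proj2 (CC s Hs))). }
assert (K1 : K 1 = (/ a * H z)%C).
{ unfold K. unfold Rpower. rewrite ln_1, Rmult_0_r, exp_0. replace (RtoC 1 * z)%C with z by ring. ring. }
intros P HP. apply locally_Cmod in HP. destruct HP as [e [He HP]].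
destruct (A (RtoC 0)) as [l Dl]. rewrite Cmod_0; lra.
apply is_cderive_continuous in Dl. destruct (proj1 (Ccontinuous_eps _ _) Dl 1 Rlt_0_1) as [d [Hd KH]].
set (M := Cmod (H (RtoC 0)) + 1).
assert (HM : 0 < M) by (unfold M; generalize (Cmod_ge_0 (H (RtoC 0))); lra).
(* Below [e'] one has [x^a M / a < e], which bounds the lower boundary term [K x]. *)
set (e' := Rpower (e * a / M) (/ a)).
assert (He' : 0 < e') by apply exp_pos.
assert (HD : 0 < Rmin (Rmin d 1) e') by (repeat apply Rmin_glb_lt; lra).
apply (Filter_prod _ _ _ (fun x => 0 < x < Rmin (Rmin d 1) e') (fun y => y = 1)).
- exists (mkposreal _ HD). intros x Hx Hx0. split; auto.
  change (Rabs (x - 0) < Rmin (Rmin d 1) e') in Hx. rewrite Rminus_0_r, Rabs_pos_eq in Hx; lra.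
- reflexivity.
- intros x y [Hx0 Hx] Hy. subst y.
  assert (X1 := Rlt_le_trans _ _ _ Hx (Rmin_r _ _)).
  assert (X2 := Rlt_le_trans _ _ _ Hx (Rmin_l _ _)).
  assert (X3 := Rlt_le_trans _ _ _ X2 (Rmin_l _ _)).
  assert (X4 := Rlt_le_trans _ _ _ X2 (Rmin_r _ _)).
  exists (K 1 - K x)%C. split. apply I; lra.
  apply HP. rewrite K1. replace (/ a * H z - K x - / a * H z)%C with (- K x)%C by ring.
  rewrite Cmod_opp. unfold K. rewrite !Cmod_mult, Cmod_inv, !Cmod_R by auto.
  rewrite (Rabs_pos_eq a), (Rabs_pos_eq (Rpower x a)) by (try apply Rlt_le, exp_pos; lra).
  assert (BH : Cmod (H (x * z)%C) <= M).
  { specialize (KH (x * z)%C). replace (x * z - 0)%C with (x * z)%C in KH by ring.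
    assert (Cmod (x * z) < d). { rewrite Cmod_mult, Cmod_R, Rabs_pos_eq by lra. nra. }
    specialize (KH H0). replace (H (x * z)%C) with (H (x * z)%C - H (RtoC 0) + H (RtoC 0))%C by ring.
    eapply Rle_trans. apply Cmod_triangle. unfold M; lra. }
  assert (BP : Rpower x a < e * a / M).
  { apply Rpower_lt_small; auto. apply Rdiv_lt_0_compat; auto. apply Rmult_lt_0_compat; auto. }
  apply Rmult_lt_reg_l with a; auto. rewrite <- Rmult_assoc, Rinv_r, Rmult_1_l by lra.
  apply Rle_lt_trans with (Rpower x a * M). apply Rmult_le_compat_l; auto. apply Rlt_le, exp_pos.
  apply Rmult_lt_compat_r with (r := M) in BP; auto. unfold Rdiv in BP.
  rewrite !Rmult_assoc, Rinv_l in BP by lra. lra.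
Qed.

Lemma is_Cseries_geom (z : C) : Cmod z < 1 -> is_Cseries (fun k => z ^ k)%C (/ (1 - z))%C.
Proof.
intros Hz. assert (C0 := Cmod_ge_0 z).
assert (N : (1 - z)%C <> RtoC 0).
{ intros E. assert (z = RtoC 1). { replace z with (1 - (1 - z))%C by ring. rewrite E; ring. }
  rewrite H, Cmod_1 in Hz. lra. }
assert (G : forall n, sum_n (fun k => z ^ k)%C n = (/ (1 - z) * (1 - z ^ S n))%C).
{ induction n. rewrite sum_O. simpl. field; auto.
  rewrite sum_Sn, IHn. unfold plus; simpl. field; auto. }
apply is_Cseries_of_remainder with (Cmod (/ (1 - z))) (Cmod z). lra.
intros n. rewrite G. replace (/ (1 - z) - / (1 - z) * (1 - z ^ S n))%C with (/ (1 - z) * z ^ S n)%C by ring.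
rewrite Cmod_mult, Cmod_pow. apply Rmult_le_compat_l. apply Cmod_ge_0.
simpl. assert (0 <= Cmod z ^ n) by (apply pow_le; auto). nra.
Qed.

(** * The extremal function *)

(* Coefficients of [beta + (1 - beta) (1 + z) / (1 - z)]. *)
Definition half_plane_coef (beta : R) (k : nat) : R := match k with O => 1 | _ => 2 * (1 - beta) end.

(** [D / alpha] multiplies the [k]-th coefficient by [(alpha + k) / alpha]; inverting it [j] times
    on the half-plane series gives these numbers. *)
Definition extremal_coef (alpha beta : R) (j k : nat) : C :=
  RtoC ((alpha / (alpha + INR k)) ^ j * half_plane_coef beta k).

(** Equal to [beta + (1 - beta) (1 + z) / (1 - z)], in the form read off from its power series. *)
Definition half_plane_map (beta : R) (z : C) : C := (1 + 2 * (1 - beta)%R * (z / (1 - z)))%C.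

Lemma one_minus_neq_0 (z : C) : Cmod z < 1 -> (1 - z)%C <> RtoC 0.
Proof.
intros Hz E. assert (z = RtoC 1). { replace z with (1 - (1 - z))%C by ring. rewrite E; ring. }
rewrite H, Cmod_1 in Hz. lra.
Qed.

Lemma Cpseries_half_plane_coef (beta : R) (z : C) : Cmod z < 1 ->
  Cpseries (fun k => RtoC (half_plane_coef beta k)) z = half_plane_map beta z.
Proof.
intros Hz. assert (N := one_minus_neq_0 z Hz). apply Cseries_unique. apply is_Cseries_incr.
unfold half_plane_map. simpl half_plane_coef.
replace (1 + 2 * (1 - beta)%R * (z / (1 - z)) - 1 * z ^ 0)%C with
  (RtoC (2 * (1 - beta)) * z * / (1 - z))%C.
2: { rewrite RtoC_mult. simpl. field; auto. }
apply is_Cseries_ext with (2 := is_Cseries_scal (RtoC (2 * (1 - beta)) * z)%C _ _ (is_Cseries_geom z Hz)).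
intros k. rewrite Cpow_S. ring.
Qed.

(** Multiplying numerator and denominator by [1 - conj z] leaves the real part
    [(1 - |z|^2) / |1 - z|^2], scaled by [1 - beta] and shifted by [beta]. *)
Lemma half_plane_map_re (beta : R) (z : C) : beta < 1 -> Cmod z < 1 -> beta < Re (half_plane_map beta z).
Proof.
intros Hb Hz. assert (N := one_minus_neq_0 z Hz).
assert (E : half_plane_map beta z = (RtoC beta + RtoC (1 - beta) * (RtoC (/ Cmod (1 - z) ^ 2) * ((1 + z) * (1 - Cconj z))))%C).
{ unfold half_plane_map. rewrite RtoC_inv.
  2: { apply pow_nonzero. intros X. apply N. apply Cmod_eq_0; auto. }
  rewrite Cmod_sqr. rewrite Cminus_conj.
  replace (Cconj 1) with (RtoC 1) by (apply C_ext; unfold Re, Im; simpl; ring).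
  assert (N' : (1 - Cconj z)%C <> RtoC 0) by (apply one_minus_neq_0; rewrite Cmod_conj; auto).
  rewrite RtoC_minus. field. auto. }
rewrite E.
assert (RR : forall (x : R) (w : C), Re (RtoC x * w)%C = x * Re w) by (intros; unfold Re, Im, RtoC; simpl; ring).
change (beta < beta + Re (RtoC (1 - beta) * (RtoC (/ Cmod (1 - z) ^ 2) * ((1 + z) * (1 - Cconj z))))%C).
rewrite !RR.
assert (0 < (1 - beta) * (/ Cmod (1 - z) ^ 2 * Re ((1 + z) * (1 - Cconj z))%C)); [|lra].
apply Rmult_lt_0_compat. lra. apply Rmult_lt_0_compat.
apply Rinv_0_lt_compat, pow_lt, Cmod_gt_0; auto.
assert (C2 := Cmod2_alt z). assert (C0 := Cmod_ge_0 z).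
replace (Re ((1 + z) * (1 - Cconj z))%C) with (1 - (Re z ^ 2 + Im z ^ 2)) by (unfold Re, Im; simpl; ring).
rewrite <- C2. nra.
Qed.

Lemma extremal_ratio_bound (alpha : R) (j k : nat) : 0 < alpha -> 0 < (alpha / (alpha + INR k)) ^ j <= 1.
Proof.
intros Ha. assert (N := pos_INR k).
assert (0 < alpha / (alpha + INR k)) by (apply Rdiv_lt_0_compat; lra).
split. apply pow_lt; auto. rewrite <- (pow1 j). apply pow_incr. split. lra.
apply Rmult_le_reg_r with (alpha + INR k). lra. unfold Rdiv. rewrite Rmult_assoc, Rinv_l; lra.
Qed.

Lemma cv_disk_extremal_coef (alpha beta : R) (j : nat) : 0 < alpha -> 0 <= beta < 1 ->
  cv_disk 1 (extremal_coef alpha beta j).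
Proof.
intros Ha Hb. apply cv_disk_geom with 2. lra.
intros k. rewrite pow1. unfold extremal_coef. rewrite Cmod_R, Rabs_mult.
destruct (extremal_ratio_bound alpha j k Ha). rewrite (Rabs_pos_eq (_ ^ j)) by lra.
assert (Rabs (half_plane_coef beta k) <= 2) by (destruct k; simpl; rewrite Rabs_pos_eq; lra).
assert (0 <= Rabs (half_plane_coef beta k)) by apply Rabs_pos.
unfold Rdiv. rewrite Rinv_1. nra.
Qed.

Lemma extremal_coef_S (alpha beta : R) (j k : nat) : 0 < alpha ->
  (RtoC alpha * extremal_coef alpha beta j k = (alpha + 1 * INR k) * extremal_coef alpha beta (S j) k)%C.
Proof.
intros Ha. assert (N := pos_INR k). unfold extremal_coef.
rewrite <- !RtoC_mult, <- RtoC_plus, <- RtoC_mult. f_equal. simpl. field. lra.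
Qed.

Lemma extremal_coef_iter (alpha beta : R) (j k : nat) : 0 < alpha ->
  ((alpha + 1 * INR k) ^ j * extremal_coef alpha beta j k = RtoC (alpha ^ j) * RtoC (half_plane_coef beta k))%C.
Proof.
intros Ha. assert (N := pos_INR k). unfold extremal_coef.
rewrite <- !RtoC_mult, <- RtoC_plus, <- RtoC_pow, <- !RtoC_mult. f_equal.
unfold Rdiv. rewrite Rmult_1_l, Rpow_mult_distr, pow_inv. field. apply pow_nonzero. lra.
Qed.

(** Consecutive series satisfy [alpha H_j = alpha H_(j+1) + z H_(j+1)'], the relation of
    [euler_relation_pos] with [a = alpha], so positivity passes from [j] to [j + 1]. The base case
    is the half-plane map, with [beta >= 0]. *)
Lemma extremal_pos (alpha beta : R) (j : nat) (z : C) : 0 < alpha -> 0 <= beta < 1 -> Cmod z < 1 ->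
  0 < Re (Cpseries (extremal_coef alpha beta j) z).
Proof.
intros Ha Hb. revert z. induction j as [|j IH]; intros z Hz.
- rewrite (Cpseries_ext _ (fun k => RtoC (half_plane_coef beta k))).
  rewrite Cpseries_half_plane_coef by auto. assert (X := half_plane_map_re beta z ltac:(lra) Hz). lra.
  intros k. unfold extremal_coef. simpl. rewrite Rmult_1_l. reflexivity.
- assert (V := cv_disk_extremal_coef alpha beta (S j) Ha Hb).
  apply (euler_relation_pos alpha _ (Cpseries (extremal_coef alpha beta j))); auto.
  + intros w Hw. eexists. apply is_cderive_Cpseries with 1; auto.
  + rewrite Cpseries_0. unfold extremal_coef. simpl. rewrite Rplus_0_r.
    replace (alpha / alpha) with 1 by (field; lra). rewrite pow1. lra.
  + intros w Hw. rewrite (is_C_derive_unique _ _ _ (is_cderive_Cpseries 1 _ w V Hw)).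
    replace (w * Cpseries (dcoef (extremal_coef alpha beta (S j))) w)%C with (1 * (w * Cpseries (dcoef (extremal_coef alpha beta (S j))) w))%C by ring.
    rewrite <- (Cpseries_lin 1) by auto.
    replace (alpha * Cpseries (extremal_coef alpha beta j) w)%C with
     (alpha * Cpseries (extremal_coef alpha beta j) w + 0 * (w * Cpseries (dcoef (extremal_coef alpha beta j)) w))%C by ring.
    rewrite <- (Cpseries_lin 1) by (auto; apply cv_disk_extremal_coef; auto).
    apply Cpseries_ext. intros k. rewrite <- extremal_coef_S by auto. ring.
Qed.

Lemma extremal_coef_0 (alpha beta : R) (j : nat) : 0 < alpha -> extremal_coef alpha beta j 0 = RtoC 1.
Proof.
intros Ha. unfold extremal_coef. simpl. rewrite Rplus_0_r.
replace (alpha / alpha) with 1 by (field; lra). rewrite pow1, Rmult_1_r. reflexivity.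
Qed.

Lemma theorem3p9_sharpness (n : nat) (alpha beta c : R) :
  0 <= beta < 1 -> 0 < alpha -> 0 < alpha + c ->
  exists F f h : C -> C,
       class_T n alpha beta F /\ integral_relation alpha c F f h /\
       Re (salagean_quot n alpha h (RtoC (- r0 alpha c))) = beta.
Proof.
intros Hb Ha Hc. destruct (r0_root alpha c Hc) as [Hr Er].
set (a := alpha + c) in *. set (r := r0 alpha c) in *.
assert (a0 : RtoC a <> RtoC 0) by (intros X; apply RtoC_inj in X; lra).
assert (An : 0 < alpha ^ n) by (apply pow_lt; auto).
assert (An0 : RtoC (alpha ^ n) <> RtoC 0) by (intros X; apply RtoC_inj in X; lra).
set (u := extremal_coef alpha beta n).
assert (Hu : cv_disk 1 u) by (apply cv_disk_extremal_coef; auto).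
set (v := fun k => ((1 + / a * INR k) * u k)%C).
assert (Hv : cv_disk 1 v) by (apply cv_disk_lin_coef; auto).
set (p := fun k => RtoC (half_plane_coef beta k)).
assert (Hp : cv_disk 1 p).
{ apply cv_disk_le with (2 := cv_disk_extremal_coef alpha beta 0 Ha Hb). intros k.
  unfold extremal_coef, p. simpl. rewrite Rmult_1_l. lra. }
set (H := Cpseries u). set (h := Cpseries v).
assert (AH : analytic_in 1 H) by (intros w Hw; eexists; apply is_cderive_Cpseries with 1; auto).
assert (Ah : analytic_in 1 h) by (intros w Hw; eexists; apply is_cderive_Cpseries with 1; auto).
assert (u0 : u O = RtoC 1) by (apply extremal_coef_0; auto).
assert (H0 : H (RtoC 0) = RtoC 1) by (unfold H; rewrite Cpseries_0; auto).
assert (h0 : h (RtoC 0) = RtoC 1) by (unfold h; rewrite Cpseries_0; unfold v; rewrite u0; simpl; ring).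
assert (B : power_branch 1 alpha (fun z => z * Cexp (/ alpha * Clog (H z)))%C H).
{ apply power_branch_of_pos_re; auto. lra. intros z Hz. apply extremal_pos; auto. }
assert (E : forall w, Cmod w < 1 -> (a * h w = a * H w + w * C_derive H w)%C).
{ intros w Hw. unfold h, v. rewrite (Cpseries_lin 1) by auto. unfold H.
  rewrite (is_C_derive_unique _ _ _ (is_cderive_Cpseries 1 _ w Hu Hw)). field. auto. }
(* Positivity of [Re h] is guaranteed only near 0, where [h] is close to 1, so the branch of [f] is
   taken on a small disk. *)
destruct (pos_re_near 1 h Rlt_0_1 Ah) as [d [Hd Pd]].
{ rewrite h0. unfold Re, RtoC; simpl; lra. }
assert (Bh : power_branch d alpha (fun z => z * Cexp (/ alpha * Clog (h z)))%C h).
{ apply power_branch_of_pos_re; auto. lra. intros w Hw. apply Ah. lra. }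
exists (fun z => z * Cexp (/ alpha * Clog (H z)))%C, (fun z => z * Cexp (/ alpha * Clog (h z)))%C, h.
split; [|split].
- split. apply power_branch_class_A with alpha H; auto.
  exists H. split; auto. intros z Hz. unfold salagean_quot.
  destruct (salagean_iter_Cpseries 1 alpha u H n Hu (fun _ _ => eq_refl)) as [_ S1].
  rewrite S1 by auto.
  (* A constant multiple, put in the shape of [Cpseries_lin] with [d = 0]. *)
  rewrite (Cpseries_ext _ (fun k => (RtoC (alpha ^ n) + 0 * INR k) * p k)%C).
  2: { intros k. unfold u. rewrite extremal_coef_iter by auto. unfold p. ring. }
  rewrite (Cpseries_lin 1) by auto. unfold p at 1. rewrite Cpseries_half_plane_coef by auto.
  replace ((RtoC (alpha ^ n) * half_plane_map beta z + 0 * (z * Cpseries (dcoef p) z)) / RtoC (alpha ^ n))%C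
    with (half_plane_map beta z) by (field; auto).
  apply half_plane_map_re; auto; lra.
- exists H. split; auto. split; auto. split. exists d. split. lra. auto.
  intros z Hz. exists (/ a * H z)%C. split. apply euler_relation_integral; auto.
  fold a. field. auto.
- set (z := RtoC (- r)).
  assert (Hz : Cmod z < 1). { unfold z. rewrite Cmod_R, Rabs_Ropp, Rabs_pos_eq; lra. }
  unfold salagean_quot.
  destruct (salagean_iter_Cpseries 1 alpha v h n Hv (fun _ _ => eq_refl)) as [_ S2].
  rewrite S2 by auto.
  rewrite (Cpseries_ext _ (fun k => (RtoC (alpha ^ n) + RtoC (alpha ^ n) / a * INR k) * p k)%C).
  2: { intros k. unfold v. replace ((alpha + 1 * INR k) ^ n * ((1 + / a * INR k) * u k))%C with
    ((1 + / a * INR k) * ((alpha + 1 * INR k) ^ n * u k))%C by ring. unfold u. rewrite extremal_coef_iter by auto.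
    unfold p. field. auto. }
  rewrite (Cpseries_lin 1) by auto.
  (* The derived series is evaluated by differentiating the closed form of the series. *)
  assert (D : Cpseries (dcoef p) z = (2 * (1 - beta)%R * (/ ((1 - z) * (1 - z))))%C).
  { apply is_cderive_unique with (Cpseries p) z. apply is_cderive_Cpseries with 1; auto.
    apply is_cderive_disk_ext with (half_plane_map beta) 1; auto.
    intros w Hw. symmetry. apply Cpseries_half_plane_coef; auto.
    assert (N := one_minus_neq_0 z Hz).
    eapply is_cderive_eq. unfold half_plane_map. apply is_cderive_plus. apply is_cderive_const. apply is_cderive_scal.
    apply is_cderive_mult. apply is_cderive_id. apply (is_cderive_comp Cinv (fun w => 1 - w)%C). apply is_cderive_inv; auto.
    apply is_cderive_minus. apply is_cderive_const. apply is_cderive_id. cbv beta. field. auto. }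
  rewrite D. unfold p. rewrite Cpseries_half_plane_coef by auto.
  assert (N := one_minus_neq_0 z Hz).
  unfold half_plane_map.
  replace ((RtoC (alpha ^ n) * (1 + 2 * (1 - beta)%R * (z / (1 - z))) + RtoC (alpha ^ n) / a *
    (z * (2 * (1 - beta)%R * / ((1 - z) * (1 - z))))) / RtoC (alpha ^ n))%C with
    (RtoC (1 + 2 * (1 - beta) * (- r / (1 + r)) + / a * (- r * (2 * (1 - beta) * / ((1 + r) * (1 + r)))))).
  + unfold Re, RtoC; simpl.
    (* The excess of [q (- r)] over [beta] is proportional to [a (1 - r^2) - 2 r], which vanishes by
       the equation for [r0]. *)
    replace (1 + 2 * (1 - beta) * (- r / (1 + r)) + / a * (- r * (2 * (1 - beta) * / ((1 + r) * (1 + r))))) with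
     (beta + (1 - beta) * (a * (1 - r ^ 2) - 2 * r) / (a * ((1 + r) * (1 + r)))) by (field; lra).
    rewrite Er. field. lra.
  + assert (R1 : RtoC (1 + r) = (1 - z)%C) by (unfold z; rewrite RtoC_opp, RtoC_plus; ring).
    assert (N1 : 1 + r <> 0) by lra.
    rewrite !RtoC_plus, !RtoC_mult, RtoC_div, !RtoC_inv, RtoC_mult, R1 by (try apply Rmult_integral_contrapositive_currified; lra).
    fold z. field. auto.
Qed.

Theorem theorem3p9 (n : nat) (alpha beta c : R)
  (hbeta : 0 <= beta < 1) (halpha : 0 < alpha) (hc : 0 < alpha + c) :
  (forall F f h : C -> C,
     class_T n alpha beta F -> integral_relation alpha c F f h ->
     forall z : C, Cmod z < r0 alpha c -> beta < Re (salagean_quot n alpha h z))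
  /\
  (forall r : R, r0 alpha c < r ->
     exists F f h : C -> C,
       class_T n alpha beta F /\ integral_relation alpha c F f h /\
       exists z : C, Cmod z < 1 /\ Cmod z < r /\
         ~ (beta < Re (salagean_quot n alpha h z))).
Proof.
split.
- intros F f h HF Hf z Hz. apply (theorem3p9_inclusion n alpha beta c F f h z); auto.
- intros r Hr. destruct (r0_root alpha c hc) as [Hr0 _].
  destruct (theorem3p9_sharpness n alpha beta c hbeta halpha hc) as [F [f [h [HF [Hf E]]]]].
  (* One example and one point serve every [r]: [- r0] has modulus below [r], and equality there
     violates the strict inequality. *)
  exists F, f, h. split; auto. split; auto. exists (RtoC (- r0 alpha c)).
  rewrite Cmod_R, Rabs_Ropp, Rabs_pos_eq by lra. rewrite E. repeat split; lra.
Qed.
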